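(* Let the pair of random variables $(X,Y)$ (with $X$ real valued and $Y\ge 0$) follow a bivariate Sarmanov distribution with marginal distribution functions $F$ of $X$ and $G$ of $Y$, kernels $\phi_1,\phi_2$ and parameter $\theta\in\mathbb{R}$, and assume that $\lim_{x\to\infty}\phi_1(x)=d_1$ for some $d_1\in\mathbb{R}$. Assume that $F\in\mathcal{D}$ and $\overline{G}(x)=o(\overline{F}(x))$ as $x\to\infty$. Suppose $XY\in RV_{-\alpha}$ for some $\alpha>0$. If $E[Y^{\alpha+\epsilon}]<\infty$ for some $\epsilon>0$, and for all $\beta\in\mathbb{R}$ $$E[Y^{\alpha+i\beta}]+\theta d_1E[\phi_2(Y)Y^{\alpha+i\beta}]\neq 0,$$ then $X\in RV_{-\alpha}$ and $$P[XY>x]\sim\left\{E[Y^{\alpha}]+\theta d_1E[\phi_2(Y)Y^{\alpha}]\right\}P[X>x]\quad\text{as }x\to\infty.$$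
   Context: Notation: for a distribution function $F$, $\overline{F}(x)=1-F(x)$. For positive functions, $a(x)\sim b(x)$ as $x\to\infty$ means $\lim_{x\to\infty}a(x)/b(x)=1$. Bivariate Sarmanov distribution: $(X,Y)$ follows a bivariate Sarmanov distribution with marginals $F$ (of $X$) and $G$ (of $Y$), kernels $\phi_1,\phi_2$ and parameter $\theta$ if $$P(X\in dx,Y\in dy)=(1+\theta\phi_1(x)\phi_2(y))F(dx)G(dy),\quad x\in\mathbb{R},\ y\ge 0,$$ where $\phi_1,\phi_2$ are real valued functions and $\theta$ is a real constant satisfying $E\{\phi_1(X)\}=E\{\phi_2(Y)\}=0$ and $1+\theta\phi_1(x)\phi_2(y)\ge 0$ for all $x\in D_X$, $y\in D_Y$; here $D_X\subset\mathbb{R}$ and $D_Y\subset\mathbb{R}^+$ are the supports of $X$ and $Y$. Regular variation: a random variable $X$ with tail $\overline F(x)=P[X>x]$ has a regularly varying tail of index $-\alpha$, $\alpha>0$, written $X\in RV_{-\alpha}$, if for all $y>0$, $\overline{F}(xy)\sim y^{-\alpha}\overline{F}(x)$ as $x\to\infty$. Dominatedly-tail-varying class: $F\in\mathcal{D}$ if for all $0<y<1$, $\limsup_{x\to\infty}\overline{F}(xy)/\overline{F}(x)<\infty$. *)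

(* Defs.v *)
From HB Require Import structures.
From mathcomp Require Import all_boot all_order all_algebra.
From mathcomp Require Export complex.
From mathcomp Require Import all_classical all_reals all_analysis.

Set Implicit Arguments.
Unset Strict Implicit.
Unset Printing Implicit Defensive.

Import Order.TTheory GRing.Theory Num.Theory.
Import numFieldNormedType.Exports.

Local Open Scope classical_set_scope.
Local Open Scope ring_scope.
Local Open Scope complex_scope.

(* a(x) ~ b(x) as x -> +oo. Since u / 0 = 0, convergence of the ratio to 1
   forces both functions to be nonzero near +oo. *)
Definition asymp_equiv (R : realType) (a b : R -> R) : Prop :=
  (fun x => a x / b x) @ +oo --> (1 : R).

Definition tail d (T : measurableType d) (R : realType) (P : probability T R)
  (f : T -> R) : R -> R := fun x => fine (P [set t | x < f t]).

Definition regularly_varying (R : realType) (alpha : R) (Fbar : R -> R) : Prop :=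
  forall y : R, 0 < y ->
    asymp_equiv (fun x => Fbar (x * y)) (fun x => y `^ (- alpha) * Fbar x).

(* The ratio Fbar (x * y) / Fbar x only makes sense for a positive tail;
   without the first conjunct a bounded law would satisfy the second one
   vacuously, because 0 / 0 = 0. *)
Definition dominatedly_varying (R : realType) (Fbar : R -> R) : Prop :=
  (forall x, 0 < Fbar x) /\
  (forall y : R, 0 < y < 1 ->
    (limf_esup (fun x : R => (Fbar (x * y) / Fbar x)%:E) (+oo%R : set_system R)
      < +oo)%E).

Definition support d (T : measurableType d) (R : realType) (P : probability T R)
  (X : {RV P >-> R}) : set R :=
  [set x | forall e : R, 0 < e -> (0 < distribution P X (ball x e))%E].

Record sarmanov d (T : measurableType d) (R : realType) (P : probability T R)
    (X Y : {RV P >-> R}) (phi1 phi2 : R -> R) (theta : R) : Prop := Sarmanov {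
  sarmanov_measurable1 : measurable_fun setT phi1 ;
  sarmanov_measurable2 : measurable_fun setT phi2 ;
  sarmanov_integrable1 : P.-integrable setT (EFin \o (phi1 \o X)) ;
  sarmanov_integrable2 : P.-integrable setT (EFin \o (phi2 \o Y)) ;
  sarmanov_mean1 : ('E_P[phi1 \o X] = 0)%E ;
  sarmanov_mean2 : ('E_P[phi2 \o Y] = 0)%E ;
  sarmanov_ge0 : forall x y, support X x -> support Y y ->
    0 <= 1 + theta * phi1 x * phi2 y ;
  sarmanov_joint : forall A : set (R * R), measurable A ->
    P [set t | A (X t, Y t)] =
    (\int[(distribution P X \x distribution P Y)%E]_(z in A)
       (1 + theta * phi1 z.1 * phi2 z.2)%:E)%E }.

(* y^(a + i b) = y^a (cos (b ln y) + i sin (b ln y)) for y > 0; for a > 0 it is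
   0 at y = 0. *)
Definition cpowR (R : realType) (y : R) (z : R[i]) : R[i] :=
  let: a +i* b := z in
  (y `^ a * cos (b * ln y)) +i* (y `^ a * sin (b * ln y)).

(* Expectation with value in R, equal to 0 when the extended expectation is
   infinite. For a Sarmanov pair whose first marginal has an unbounded support,
   theta * d1 <> 0 forces phi2 to be bounded on the support of Y, so for the
   expectations of phi2(Y) Y^alpha this convention is only used when they are
   multiplied by theta * d1 = 0. *)
Definition expect d (T : measurableType d) (R : realType) (P : probability T R)
  (f : T -> R) : R := fine 'E_P[f].

Definition cexpect d (T : measurableType d) (R : realType)
  (P : probability T R) (f : T -> R[i]) : R[i] :=
  expect P (fun t => complex.Re (f t)) +i* expect P (fun t => complex.Im (f t)).

(* Main.v *)
Require Import Defs.
From HB Require Import structures.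
From mathcomp Require Import all_boot all_order all_algebra.
From mathcomp Require Import complex.
From mathcomp Require Import all_classical all_reals all_analysis.
From mathcomp Require Import measurable_realfun.
From mathcomp Require Import ring lra.
Set Implicit Arguments.
Unset Strict Implicit.
Unset Printing Implicit Defensive.
Import Order.TTheory GRing.Theory Num.Theory.
Import numFieldNormedType.Exports.
Local Open Scope classical_set_scope.
Local Open Scope ring_scope.
Local Open Scope complex_scope.

(**
Since phi1 tends to d1, P[XY > x] is asymptotic to the multiplicative
convolution of the tail F of X with rho(dy) = (1 + theta d1 phi2 y) G(dy), a
nonnegative measure. Put U x = P[XY > x], S = ln Y, let W be Y^al times the
density of rho with respect to G, and
  g_T t = exp (al t) F (exp (T + t)) / U (exp T).
Then E[W g_T (r - S)] -> 1 as T -> oo, locally uniformly in r, and the claim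
is that g_T 0 -> 1 / E[W].

The Fejer kernel phi_l has the compactly supported Fourier transform
(1 - |b| / l)^+. As E[W exp (i b S)] never vanishes and is C^2 in b, the
quotient of the triangle by the transform of W is the transform of an
integrable psi, of size O(1 / t^2), and phi_l t = E[W psi (t + S)]. Hence
  int g_T phi_l = int psi r E[W g_T (r - S)] dr -> int psi = int phi_l / E[W].
As t |-> exp (- al t) g_T t is nonincreasing and phi_l concentrates at 0 when
l -> oo, this gives g_T 0 -> 1 / E[W]. The function g_T is truncated to a
window |t| <= L, where it is bounded uniformly in T; outside the window, F is
controlled by Potter's bound for U, and by G = o(F).
*)

(** [g_T] changes with [T], so a limit theorem for one fixed bounded function is not enough. The
    Tauberian step is an estimate whose constants [eps] and [L] depend on the bound [K] and on the
    tolerance, not on [g]; every [x = exp T] then supplies its own truncated [g].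

    The nonvanishing hypothesis gives no lower bound for the transform of [W] at infinity. A kernel
    whose transform has compact support only requires division on a segment. The moment of order
    [al + eps] dominates [Y^al |ln Y|^k], which makes the divisor smooth.

    [phi2] may be unbounded, so [theta * phi2] is first replaced by a bounded [kappa]. The error
    made by writing [d1] for [phi1] is then small where [X] is large; where [X] is bounded, [XY > x]
    forces [Y] to be large, and that event is negligible. All this is measured against [U], hence
    the need for [F = O(U)] beforehand, which comes from the probability of a rectangle. *)

Notation intble mu f := (integrable mu setT (EFin \o f)).

Lemma indic_cases (T : Type) (R : realType) (A : set T) (x : T) :
  (A x /\ \1_A x = 1 :> R) \/ (~ A x /\ \1_A x = 0 :> R).
Proof.
rewrite indicE; have [/set_mem xA|/negP xA] := boolP (x \in A); first by left.
by right; split => // Ax; apply: xA; exact: mem_set.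
Qed.

Lemma normr_indic_le1 (T : Type) (R : realType) (A : set T) (x : T) :
  `|\1_A x : R| <= 1.
Proof. by case: (indic_cases R A x) => -[_ ->]; rewrite ?normr1 ?normr0. Qed.

(** * Real-valued integrals: comparison, Fubini and translation *)

Section Rintegral_tools.
Context d (T : measurableType d) (R : realType).
Variable mu : {measure set T -> \bar R}.
Implicit Types f g : T -> R.

Lemma intble_measurable f : intble mu f -> measurable_fun setT f.
Proof. by move=> /measurable_int /measurable_EFinP. Qed.

Lemma intble_le f g : measurable_fun setT f -> (forall x, `|f x| <= g x) ->
  intble mu g -> intble mu f.
Proof.
move=> mf fg; apply: le_integrable => //; first exact/measurable_EFinP.
by move=> x _ /=; rewrite lee_fin (le_trans (fg x))// ler_norm.
Qed.

Lemma intbleD f g : intble mu f -> intble mu g -> intble mu (fun x => f x + g x).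
Proof. by move=> If Ig; exact: (@integrableD _ _ _ mu _ _ (EFin \o f) (EFin \o g)). Qed.

Lemma intbleZl c f : intble mu f -> intble mu (fun x => c * f x).
Proof. by move=> If; exact: (@integrableZl _ _ _ mu _ _ c (EFin \o f)). Qed.

Lemma intbleN f : intble mu f -> intble mu (fun x => - f x).
Proof.
move=> /(@intbleZl (-1)); apply: eq_integrable => // x _ /=.
by rewrite mulN1r.
Qed.

Lemma intbleB f g : intble mu f -> intble mu g -> intble mu (fun x => f x - g x).
Proof. by move=> If Ig; apply: intbleD => //; exact: intbleN. Qed.

Lemma intble_norm f : intble mu f -> intble mu (fun x => `|f x|).
Proof. exact: integrable_norm. Qed.

Lemma intbleMr (c : R) f g : measurable_fun setT g -> (forall x, `|g x| <= c) ->
  intble mu f -> intble mu (fun x => f x * g x).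
Proof.
move=> mg gc If; apply: (@intble_le _ (fun x => c * `|f x|)).
- by apply: measurable_funM => //; exact: intble_measurable.
- by move=> x; rewrite normrM mulrC ler_wpM2r.
- exact/intbleZl/intble_norm.
Qed.

Lemma Rintegral_le f g : intble mu f -> intble mu g -> (forall x, f x <= g x) ->
  \int[mu]_x f x <= \int[mu]_x g x.
Proof. by move=> If Ig fg; apply: le_Rintegral. Qed.

Lemma Rintegral_eq0 f : (forall x, f x = 0) -> \int[mu]_x f x = 0.
Proof. by move=> f0; rewrite /Rintegral integral0_eq// => x _; rewrite f0. Qed.

Lemma Rintegral_norm_le f g : intble mu f -> intble mu g ->
  (forall x, `|f x| <= g x) -> `|\int[mu]_x f x| <= \int[mu]_x g x.
Proof.
move=> If Ig fg; apply: (le_trans (le_normr_Rintegral _ If)) => //.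
by apply: Rintegral_le => //; exact: intble_norm.
Qed.

Lemma Rintegral_ae_eq f g : measurable_fun setT f -> measurable_fun setT g ->
  {ae mu, forall x, f x = g x} -> \int[mu]_x f x = \int[mu]_x g x.
Proof.
move=> mf mg fg; congr fine; apply: ae_eq_integral => //; try exact/measurable_EFinP.
by apply: filterS fg => x fgx _ /=; rewrite fgx.
Qed.

Lemma measurable_ltr_set f (c : R) : measurable_fun setT f -> measurable [set x | c < f x].
Proof.
move=> mf; rewrite (_ : [set x | _] = f @^-1` `]c, +oo[); last first.
  by apply/seteqP; split=> x /=; rewrite in_itv/= andbT.
by rewrite -[X in measurable X]setTI; exact: mf.
Qed.

Lemma intble_indic f (A : set T) : measurable A -> intble mu f ->
  intble mu (fun x => f x * \1_A x).
Proof.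
move=> mA If; apply: (@intbleMr 1) => //.
by move=> x; exact: normr_indic_le1.
Qed.

(** Dominated convergence along the integers gives one threshold, and monotonicity in [M] extends it
    to larger reals. Taking [|r|], [Y] or [- ln Y] for [u] serves tails at infinity and at 0
    alike. *)
Lemma Rintegral_tail f (u : T -> R) : intble mu f -> (forall x, 0 <= f x) ->
  measurable_fun setT u -> forall e, 0 < e ->
  exists2 L, 0 < L & forall M, L <= M ->
    \int[mu]_x (f x * \1_[set x | M < u x] x) <= e.
Proof.
move=> If f0 mu_ e e0.
have mind n : measurable [set x | n%:R < u x] by exact: measurable_ltr_set.
pose h n x := (f x * \1_[set x | n%:R < u x] x)%:E.
have Ih n : mu.-integrable setT (h n) by exact: intble_indic.
have : (\int[mu]_x h n x)%E @[n --> \oo] --> (\int[mu]_x cst 0%E x)%E.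
  apply: (@dominated_cvg _ _ _ mu _ _ h _ (EFin \o f)) => //.
  - by move=> n; exact: measurable_int (Ih n).
  - move=> x _; apply: cvg_near_cst; exists (Num.truncn `|u x|).+1 => // n /= un.
    rewrite /h indicE memNset ?mulr0//= => /(le_lt_trans _) xx.
    have := lt_le_trans (truncnS_gt `|u x|) (_ : _ <= n%:R); rewrite ler_nat => /(_ un).
    by move=> /(le_lt_trans (ler_norm _))/lt_trans/(_ (xx _ (lexx _))); rewrite ltxx.
  - move=> n x _; rewrite /h /= lee_fin normrM (ger0_norm (f0 x)) indicE.
    by case: (_ \in _); rewrite ?normr1 ?normr0 ?mulr1 ?mulr0.
rewrite integral0 => /fine_cvgP[_] /cvgrPdist_le /(_ e e0) [N _ /(_ N (leqnn _))].
(* [N.+1] rather than [N] keeps the threshold positive when [N = 0]. *)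
rewrite /= sub0r normrN => hN; exists N.+1%:R => // M NM.
apply: le_trans (le_trans (ler_norm _) hN).
have mM : measurable [set x | M < u x] by exact: measurable_ltr_set.
apply: Rintegral_le; [exact: intble_indic|exact: (Ih N)|] => x.
rewrite ler_wpM2l// !indicE; case: (boolP (x \in [set x | M < u x])) => //=.
rewrite inE/= => Mu; rewrite mem_set//=; apply: le_lt_trans Mu; apply: le_trans NM.
by rewrite ler_nat.
Qed.

End Rintegral_tools.

Lemma intble_bounded d (T : measurableType d) (R : realType) (P : probability T R)
    (c : R) (f : T -> R) :
  measurable_fun setT f -> (forall x, `|f x| <= c) -> intble P f.
Proof.
move=> mf fc; apply: (@intble_le _ _ _ _ _ (fun=> c)) => //.
exact: finite_measure_integrable_cst.
Qed.

Lemma Rintegral_cst_probability d (T : measurableType d) (R : realType)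
    (P : probability T R) (c : R) : \int[P]_x c = c.
Proof.
transitivity (c * fine 1%E); last by rewrite /= mulr1.
by rewrite Rintegral_cst//; congr (_ * fine _); exact: probability_setT.
Qed.

Section product_tools.
Context d1 d2 (T1 : measurableType d1) (T2 : measurableType d2) (R : realType).
Variables (m1 : {sigma_finite_measure set T1 -> \bar R}).
Variables (m2 : {sigma_finite_measure set T2 -> \bar R}).

Lemma intble_prod (f : T1 -> R) (g : T2 -> R) : intble m1 f -> intble m2 g ->
  intble (m1 \x m2)%E (fun z => f z.1 * g z.2).
Proof.
move=> If Ig.
have mf := intble_measurable If; have mg := intble_measurable Ig.
have mfg : measurable_fun setT (EFin \o (fun z : T1 * T2 => f z.1 * g z.2)).
  apply/measurable_EFinP; apply: measurable_funM.
    by apply: measurableT_comp => //; exact: measurable_fst.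
  by apply: measurableT_comp => //; exact: measurable_snd.
apply/(integrable12ltyP m1 m2 mfg).
rewrite (eq_integral (fun x => `|f x|%:E * \int[m2]_y `|g y|%:E)%E); last first.
  move=> x _ /=; under eq_integral do rewrite /= normrM EFinM.
  rewrite ge0_integralZl//.
  exact/measurable_EFinP/measurableT_comp.
rewrite ge0_integralZr//; last 2 first.
- exact/measurable_EFinP/measurableT_comp.
- exact: integral_ge0.
rewrite lte_mul_pinfty//.
- exact: integral_ge0.
- rewrite ge0_fin_numE; first by case/integrableP : If.
  exact: integral_ge0.
- by case/integrableP : Ig.
Qed.

(** [Rintegral] applies [fine] to the inner integrals, which are finite only almost everywhere; [H1]
    and [H2] remove this [fine] before Fubini's theorem is used. *)
Lemma Rintegral_swap (f : T1 -> T2 -> R) :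
  intble (m1 \x m2)%E (fun z => f z.1 z.2) ->
  \int[m1]_x \int[m2]_y f x y = \int[m2]_y \int[m1]_x f x y.
Proof.
move=> If; rewrite /Rintegral.
have H1 : (\int[m1]_x (fine (\int[m2]_y (f x y)%:E))%:E =
           \int[m1]_x \int[m2]_y (f x y)%:E)%E.
  apply: ae_eq_integral => //.
  - apply/measurable_EFinP/measurableT_comp => //.
    exact: (measurable_fubini_F If).
  - exact: (measurable_fubini_F If).
  - apply: filterS (ae_integrable1 If) => x /= Ifx _.
    by rewrite fineK//; exact: (integrable_fin_num _ Ifx).
have H2 : (\int[m2]_y (fine (\int[m1]_x (f x y)%:E))%:E =
           \int[m2]_y \int[m1]_x (f x y)%:E)%E.
  apply: ae_eq_integral => //.
  - apply/measurable_EFinP/measurableT_comp => //.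
    exact: (measurable_fubini_G If).
  - exact: (measurable_fubini_G If).
  - apply: filterS (ae_integrable2 If) => x /= Ifx _.
    by rewrite fineK//; exact: (integrable_fin_num _ Ifx).
by rewrite H1 H2; congr fine; exact: (Fubini If).
Qed.

Lemma measurable_Rintegral1 (f : T1 -> T2 -> R) :
  intble (m1 \x m2)%E (fun z => f z.1 z.2) ->
  measurable_fun setT (fun x => \int[m2]_y f x y).
Proof.
by move=> If; apply: measurableT_comp => //; exact: (measurable_fubini_F If).
Qed.

End product_tools.

Section translation.
Context (R : realType).
Let leb := @lebesgue_measure R.

Lemma lebesgue_measure_shift (a : R) (A : set R) : measurable A ->
  pushforward leb ((fun x : measurableTypeR R => x + a) : _ -> measurableTypeR R) A = leb A.
Proof.
move=> mA; apply/esym/lebesgue_measure_unique => //=.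
  by apply: measurable_funD.
move=> msh _ [[b c]] _ <-.
rewrite /pushforward.
have -> : (fun x => x + a) @^-1` [set` `]b, c]] = [set` `](b - a), (c - a)]].
  by apply/seteqP; split => x /=; rewrite !in_itv/= ltrBlDr lerBrDr.
rewrite /leb !lebesgue_measure_itv/= !lte_fin ltrD2r.
by case: ifPn => // _; rewrite -!EFinB; congr EFin; ring.
Qed.


Lemma intble_shift (a : R) (f : R -> R) : intble leb f ->
  intble leb (fun x => f (x + a)).
Proof.
move=> If; have mf := intble_measurable If.
have msh : measurable_fun setT (fun x : R => x + a).
  by apply: measurable_funD.
apply/integrableP; split.
  by apply/measurable_EFinP; exact: (measurableT_comp mf).
case/integrableP : If => mfE; apply: le_lt_trans.
rewrite le_eqVlt; apply/orP; left; apply/eqP.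
rewrite -[LHS](@ge0_integral_pushforward _ _ (measurableTypeR R)
  (measurableTypeR R) R _ msh lebesgue_measure setT
  (fun y => `|(f y)%:E|)%E)//; last first.
  exact/measurableT_comp.
by apply: eq_measure_integral => A mA _; exact: lebesgue_measure_shift.
Qed.

Lemma Rintegral_shift (a : R) (f : R -> R) : intble leb f ->
  \int[leb]_x f (x + a) = \int[leb]_x f x.
Proof.
move=> If; have mf := intble_measurable If.
have msh : measurable_fun setT (fun x : R => x + a).
  by apply: measurable_funD.
congr fine.
rewrite -[LHS](@integral_pushforward _ _ (measurableTypeR R)
  (measurableTypeR R) R _ msh lebesgue_measure setT (EFin \o f))//; last 2 first.
- exact/measurable_EFinP.
- exact: (intble_shift a If).
by apply: eq_measure_integral => A mA _; exact: lebesgue_measure_shift.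
Qed.

(** The Fejer kernels and the quotients [psi] are dominated by multiples of this function. *)
Lemma intble_oneDsqrV : intble leb (fun x => (1 + x ^+ 2)^-1).
Proof.
have mf : measurable_fun setT (fun x : R => (1 + x ^+ 2)^-1).
  apply: continuous_measurable_fun; exact: (@continuous_oneDsqrV R).
apply/integrableP; split; first exact/measurable_EFinP.
have p0 (x : R) : 0 <= (1 + x ^+ 2)^-1 by rewrite invr_ge0 addr_ge0// sqr_ge0.
under eq_integral do rewrite /= ger0_norm//.
rewrite ge0_symfun_integralT//; last 2 first.
- exact: (@continuous_oneDsqrV R).
- by move=> x /=; rewrite sqrrN.
rewrite -set_itvcy (@integral0y_oneDsqr R).
by rewrite -EFinM ltry.
Qed.

End translation.

(** * Twice continuously differentiable multipliers *)

Definition primitive_of (R : realType) (F f : R -> R) :=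
  forall x : R, is_derive x 1 F (f x).

Section primitive_of_tools.
Context (R : realType).
Implicit Types f g F G : R -> R.

Lemma primitive_of_eq F f g : primitive_of F f -> f =1 g -> primitive_of F g.
Proof. by move=> Ff fg x; rewrite -fg. Qed.

Lemma primitive_ofD F f G g : primitive_of F f -> primitive_of G g ->
  primitive_of (fun x => F x + G x) (fun x => f x + g x).
Proof. by move=> Ff Gg x; have := Ff x; have := Gg x => ? ?; exact: is_deriveD. Qed.

Lemma primitive_ofN F f : primitive_of F f ->
  primitive_of (fun x => - F x) (fun x => - f x).
Proof. by move=> Ff x; have := Ff x => ?; exact: is_deriveN. Qed.

Lemma primitive_ofB F f G g : primitive_of F f -> primitive_of G g ->
  primitive_of (fun x => F x - G x) (fun x => f x - g x).
Proof. by move=> Ff /primitive_ofN Gg; exact: primitive_ofD. Qed.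

Lemma primitive_ofM F f G g : primitive_of F f -> primitive_of G g ->
  primitive_of (fun x => F x * G x) (fun x => f x * G x + F x * g x).
Proof.
move=> Ff Gg x; have ? := Ff x; have ? := Gg x.
apply: (is_derive_eq (is_deriveM (Ff x) (Gg x))).
by rewrite /GRing.scale/=; ring.
Qed.

Lemma primitive_of_cst c : primitive_of (fun _ : R => c) (fun=> 0).
Proof. by move=> x; exact: is_derive_cst. Qed.

Lemma primitive_of_id : primitive_of (fun x : R => x) (fun=> 1).
Proof. by move=> x; exact: is_derive_id. Qed.

Lemma primitive_ofZ c F f : primitive_of F f ->
  primitive_of (fun x => c * F x) (fun x => c * f x).
Proof.
move=> Ff; apply: (primitive_of_eq (primitive_ofM (primitive_of_cst c) Ff)) => x.
by rewrite mul0r add0r.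
Qed.

Lemma primitive_ofV F f : (forall x, F x != 0) -> primitive_of F f ->
  primitive_of (fun x => (F x)^-1) (fun x => - f x / F x ^+ 2).
Proof.
move=> F0 Ff x; have ? := Ff x.
apply: (is_derive_eq (is_deriveV (F0 x) (Ff x))).
by rewrite /GRing.scale/= !mulNr mulrC.
Qed.

Lemma primitive_of_cos t :
  primitive_of (fun x : R => cos (x * t)) (fun x => - t * sin (x * t)).
Proof.
move=> x; have It := primitive_ofM primitive_of_id (primitive_of_cst t) x.
have D : is_derive x 1 (fun x => cos (x * t)) (- sin (x * t) * (1 * t + x * 0)) :=
  @is_derive1_comp R cos (fun x => x * t) x _ _ (is_derive_cos (x * t)) It.
apply: (is_derive_eq D).
by ring.
Qed.

Lemma primitive_of_sin t :
  primitive_of (fun x : R => sin (x * t)) (fun x => t * cos (x * t)).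
Proof.
move=> x; have It := primitive_ofM primitive_of_id (primitive_of_cst t) x.
have D : is_derive x 1 (fun x => sin (x * t)) (cos (x * t) * (1 * t + x * 0)) :=
  @is_derive1_comp R sin (fun x => x * t) x _ _ (is_derive_sin (x * t)) It.
apply: (is_derive_eq D).
by ring.
Qed.

Lemma primitive_of_continuous F f : primitive_of F f -> continuous F.
Proof.
move=> Ff x; have [dF _] := Ff x.
exact/differentiable_continuous/derivable1_diffP.
Qed.

Lemma primitive_of_FTC2 F f (b : R) : 0 <= b -> primitive_of F f -> continuous f ->
  \int[lebesgue_measure]_(x in `[0, b]) f x = F b - F 0.
Proof.
rewrite le_eqVlt => /predU1P[<- _ _|b0 Ff cf].
  by rewrite set_itv1 Rintegral_set1 subrr.
rewrite /Rintegral (@continuous_FTC2 _ f F)//.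
- exact: continuous_subspaceT.
- have cF := primitive_of_continuous Ff; split.
  + by move=> x _; have [] := Ff x.
  + exact/cvg_at_right_filter/cF.
  + exact/cvg_at_left_filter/cF.
- by move=> x _; rewrite derive1E; have [_ ->] := Ff x.
Qed.

(** The derivatives are explicit witnesses, so that [osc_le] can integrate by parts with them. *)
Definition C2 f := exists f1 f2,
  [/\ primitive_of f f1, primitive_of f1 f2 & continuous f2].

Lemma C2_continuous f : C2 f -> continuous f.
Proof. by case=> f1 [f2 [ff1 _ _]]; exact: primitive_of_continuous ff1. Qed.

Lemma C2_cst c : C2 (fun=> c).
Proof.
exists (fun=> 0), (fun=> 0); split; try exact: primitive_of_cst.
by move=> x; exact: cvg_cst.
Qed.

Lemma C2_id : C2 (fun x => x).
Proof.
exists (fun=> 1), (fun=> 0); split; [exact: primitive_of_id|exact: primitive_of_cst|].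
by move=> x; exact: cvg_cst.
Qed.

Lemma C2D f g : C2 f -> C2 g -> C2 (fun x => f x + g x).
Proof.
move=> [f1 [f2 [ff1 ff2 cf]]] [g1 [g2 [gg1 gg2 cg]]].
exists (fun x => f1 x + g1 x), (fun x => f2 x + g2 x).
split; [exact: primitive_ofD|exact: primitive_ofD|].
by move=> x; apply: cvgD; [exact: cf|exact: cg].
Qed.

Lemma C2M f g : C2 f -> C2 g -> C2 (fun x => f x * g x).
Proof.
move=> [f1 [f2 [ff1 ff2 cf]]] [g1 [g2 [gg1 gg2 cg]]].
exists (fun x => f1 x * g x + f x * g1 x).
exists (fun x => (f2 x * g x + f1 x * g1 x) + (f1 x * g1 x + f x * g2 x)).
have c0 := primitive_of_continuous ff1; have c1 := primitive_of_continuous ff2.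
have d0 := primitive_of_continuous gg1; have d1 := primitive_of_continuous gg2.
split; first exact: primitive_ofM.
  by apply: primitive_ofD; exact: primitive_ofM.
move=> x; apply: cvgD; apply: cvgD; apply: cvgM;
  by [exact: cf|exact: cg|exact: c0|exact: c1|exact: d0|exact: d1].
Qed.

Lemma C2V f : (forall x, f x != 0) -> C2 f -> C2 (fun x => (f x)^-1).
Proof.
move=> f0 [f1 [f2 [ff1 ff2 cf]]].
have VV := primitive_ofV f0 ff1.
exists (fun x => - f1 x * ((f x)^-1 * (f x)^-1)).
exists (fun x => - f2 x * ((f x)^-1 * (f x)^-1) + - f1 x *
  ((- f1 x / f x ^+ 2) * (f x)^-1 + (f x)^-1 * (- f1 x / f x ^+ 2))).
have c0 := primitive_of_continuous ff1; have c1 := primitive_of_continuous ff2.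
split.
- apply: primitive_of_eq VV _ => x; rewrite -invfM expr2//.
- apply: primitive_ofM; first exact: primitive_ofN.
  by apply: primitive_ofM.
- have cV x : {for x, continuous (fun x => (f x)^-1)} by apply: cvgV => //; exact: c0.
  have cN1 x : {for x, continuous (fun x => - f1 x)} by apply: cvgN; exact: c1.
  have cN2 x : {for x, continuous (fun x => - f2 x)} by apply: cvgN; exact: cf.
  have cW x : {for x, continuous (fun x => - f1 x / f x ^+ 2)}.
    apply: cvgM; first exact: cN1.
    apply: cvgV; first by rewrite sqrf_eq0.
    by under eq_fun do rewrite expr2; rewrite expr2; apply: cvgM; exact: c0.
  move=> x; apply: cvgD; first by apply: cvgM; [exact: cN2|apply: cvgM; exact: cV].
  by apply: cvgM; [exact: cN1|apply: cvgD; apply: cvgM; by [exact: cV|exact: cW]].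
Qed.

End primitive_of_tools.

(** * Decay of cosine and sine integrals with smooth coefficients *)

Section oscillatory.
Context (R : realType).
Let leb : {measure set (measurableTypeR R) -> \bar R} := @lebesgue_measure R.
Variables (p q : R -> R) (lam : R).
Hypotheses (lam0 : 0 < lam) (C2p : C2 p) (C2q : C2 q).
Hypotheses (plam : p lam = 0) (qlam : q lam = 0) (q0 : q 0 = 0).

(** The integrand is the real part of [(p + i q) exp (- i b t)]. With [p] extended evenly and [q]
    oddly to [[- lam, lam]], this is half the Fourier transform of [p + i q]; [q 0 = 0] makes the
    odd extension continuous. *)
Definition osc t := \int[leb]_(b in `[0, lam]) (p b * cos (b * t) + q b * sin (b * t)).

Let seg_intble (f : R -> R) : continuous f -> leb.-integrable `[0, lam] (EFin \o f).
Proof.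
move=> cf; apply: continuous_compact_integrable; first exact: segment_compact.
exact: continuous_subspaceT.
Qed.

Lemma seg_bounded (f : R -> R) : continuous f ->
  exists2 M, 0 <= M & forall x, 0 <= x <= lam -> `|f x| <= M.
Proof.
move=> cf; have : compact (f @` `[0, lam]).
  by apply: continuous_compact; [exact: continuous_subspaceT|exact: segment_compact].
move=> /compact_bounded [M [Mr MM]]; exists (`|M| + 1); first by rewrite addr_ge0.
move=> x x0l; apply: (MM (`|M| + 1)).
  by rewrite (le_lt_trans (ler_norm _))// ltrDl.
by exists x => //; rewrite /= in_itv.
Qed.

Let osc_int_bound (f g : R -> R) : continuous f -> continuous g ->
  exists2 M, 0 <= M & forall t,
   `|\int[leb]_(b in `[0, lam]) (f b * cos (b * t) + g b * sin (b * t))| <= M.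
Proof.
move=> cf cg.
have [Mf Mf0 hf] := seg_bounded cf; have [Mg Mg0 hg] := seg_bounded cg.
exists ((Mf + Mg) * lam); first by rewrite mulr_ge0 ?addr_ge0// ltW.
move=> t; have cI : continuous (fun b => f b * cos (b * t) + g b * sin (b * t)).
  move=> x; apply: cvgD; apply: cvgM; [exact: cf| |exact: cg|].
    exact: (primitive_of_continuous (@primitive_of_cos R t)).
  exact: (primitive_of_continuous (@primitive_of_sin R t)).
apply: le_trans (le_normr_Rintegral _ (seg_intble cI)) _ => //.
apply: (@le_trans _ _ (\int[leb]_(b in `[0, lam]) (Mf + Mg))).
  apply: le_Rintegral => //.
  - exact/integrable_norm/seg_intble.
  - by apply: seg_intble => x; exact: cvg_cst.
  - move=> x /=; rewrite in_itv/= => x0l.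
    apply: (le_trans (ler_normD _ _)); rewrite !normrM lerD//.
      rewrite -[leRHS]mulr1 ler_pM ?hf//.
      by rewrite ler_norml cos_geN1 cos_le1.
    rewrite -[leRHS]mulr1 ler_pM ?hg//.
    by rewrite ler_norml sin_geN1 sin_le1.
rewrite Rintegral_cst//= /leb lebesgue_measure_itv/= lte_fin lam0.
by rewrite oppr0 addr0.
Qed.

(** As [p lam = q lam = q 0 = 0], the boundary terms of order [t] vanish. There remain [K], from the
    first derivatives at the endpoints, and [N], from the integral of the second ones; [M] bounds
    [osc] itself. *)
Lemma osc_le : exists2 C, 0 <= C & forall t, `|osc t| <= C * (1 + t ^+ 2)^-1.
Proof.
case: (C2p) => p1 [p2 [pp1 pp2 cp2]]; case: (C2q) => q1 [q2 [qq1 qq2 cq2]].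
have [M M0 hM] := osc_int_bound (C2_continuous C2p) (C2_continuous C2q).
have [N N0 hN] := osc_int_bound cp2 cq2.
pose K := `|p1 lam| + `|q1 lam| + `|p1 0|.
exists (M + (K + N)); first by rewrite !addr_ge0.
move=> t; rewrite ler_pdivlMr ?ltr_pwDl ?sqr_ge0//.
rewrite mulrDr mulr1 lerD ?hM//.
have -> : `|osc t| * t ^+ 2 = `|t ^+ 2 * osc t|.
  by rewrite normrM mulrC (ger0_norm (sqr_ge0 t)).
(* [D] is a primitive of [t ^+ 2] times the integrand of [osc], up to the
   remainder [p2 cos + q2 sin]: two integrations by parts at once. *)
pose D b := (t * (p b * sin (b * t)) - t * (q b * cos (b * t))) +
            (p1 b * cos (b * t) + q1 b * sin (b * t)).
pose D' b := t ^+ 2 * (p b * cos (b * t) + q b * sin (b * t)) +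
            (p2 b * cos (b * t) + q2 b * sin (b * t)).
have DD' : primitive_of D D'.
  have pc := @primitive_of_cos R t; have ps := @primitive_of_sin R t.
  rewrite /D; apply: primitive_of_eq.
    apply: primitive_ofD.
      apply: primitive_ofB; apply: primitive_ofZ.
        exact: (primitive_ofM pp1 ps).
      exact: (primitive_ofM qq1 pc).
    by apply: primitive_ofD; [exact: (primitive_ofM pp2 pc)|exact: (primitive_ofM qq2 ps)].
  move=> x; rewrite /D'; ring.
have cosc (f g : R -> R) : continuous f -> continuous g ->
    continuous (fun b => f b * cos (b * t) + g b * sin (b * t)).
  move=> cf cg x; apply: cvgD; apply: cvgM; [exact: cf| |exact: cg|].
    exact: (primitive_of_continuous (@primitive_of_cos R t)).
  exact: (primitive_of_continuous (@primitive_of_sin R t)).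
have c0 := cosc _ _ (C2_continuous C2p) (C2_continuous C2q).
have c2 := cosc _ _ cp2 cq2.
have cD' : continuous D'.
  move=> x; apply: cvgD; last exact: c2.
  by apply: cvgM; [exact: cvg_cst|exact: c0].
have := primitive_of_FTC2 (ltW lam0) DD' cD'.
rewrite /D' RintegralD//; last 2 first.
- by apply: seg_intble => x; apply: cvgM; [exact: cvg_cst|exact: c0].
- exact: seg_intble.
rewrite RintegralZl//; last exact: seg_intble.
rewrite -/(osc t) => /(canRL (addrK _)) ->.
apply: (le_trans (ler_normB _ _)); rewrite lerD ?hN//.
rewrite /D plam qlam q0 !mul0r !mulr0 cos0 sin0 ?mulr0 ?mulr1 ?subr0 ?add0r ?addr0.
apply: (le_trans (ler_normB _ _)); rewrite lerD//.
apply: (le_trans (ler_normD _ _)); rewrite !normrM lerD//.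
  by rewrite ler_piMr// ler_norml cos_geN1 cos_le1.
by rewrite ler_piMr// ler_norml sin_geN1 sin_le1.
Qed.

End oscillatory.

(** * Fourier transform of a weight along a random variable *)

Section fourier_transform.
Context d (T : measurableType d) (R : realType).
Variables (mu : {measure set T -> \bar R}) (S : T -> R).
Hypothesis mS : measurable_fun setT S.

Lemma normr_cos (x : R) : `|cos x| <= 1.
Proof. by rewrite ler_norml cos_geN1 cos_le1. Qed.

Lemma normr_sin (x : R) : `|sin x| <= 1.
Proof. by rewrite ler_norml sin_geN1 sin_le1. Qed.

Lemma measurable_cosM b : measurable_fun setT (fun t => cos (b * S t)).
Proof.
apply: (measurableT_comp (continuous_measurable_fun (@continuous_cos R))).
exact: measurable_funM.
Qed.

Lemma measurable_sinM b : measurable_fun setT (fun t => sin (b * S t)).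
Proof.
apply: (measurableT_comp (continuous_measurable_fun (@continuous_sin R))).
exact: measurable_funM.
Qed.

(** Together with [fsin]: real and imaginary parts of the Fourier transform of the image under [S]
    of the measure with density [V]. *)
Definition fcos V b := \int[mu]_t (V t * cos (b * S t)).
Definition fsin V b := \int[mu]_t (V t * sin (b * S t)).

Lemma intble_cos V b : intble mu V -> intble mu (fun t => V t * cos (b * S t)).
Proof.
apply: (@intbleMr _ _ _ _ 1); first exact: measurable_cosM.
by move=> x; exact: normr_cos.
Qed.

Lemma intble_sin V b : intble mu V -> intble mu (fun t => V t * sin (b * S t)).
Proof.
apply: (@intbleMr _ _ _ _ 1); first exact: measurable_sinM.
by move=> x; exact: normr_sin.
Qed.

Lemma fourier_derive (F F' : R -> T -> R) (G : T -> R) :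
  (forall b, intble mu (F b)) ->
  (forall t, primitive_of (F^~ t) (F'^~ t)) -> intble mu G ->
  (forall b t, `|F' b t| <= G t) ->
  primitive_of (fun b => \int[mu]_t F b t) (fun b => \int[mu]_t F' b t).
Proof.
move=> IF FF' IG F'G b.
have hI : `](b - 1), (b + 1)[%classic b by rewrite /= in_itv/= ltrBlDr !ltrDl !ltr01.
have d1E x t : partial1of2 F x t = F' x t.
  by rewrite partial1of2E; have [_ ->] := FF' t x.
have G0 t : 0 <= G t by exact: le_trans (F'G b t).
have hd : forall x t, `](b - 1), (b + 1)[%classic x -> setT t -> derivable (F^~ t) x 1.
  by move=> x t _ _; have [] := FF' t x.
have hG : forall x t, `](b - 1), (b + 1)[%classic x -> setT t -> `|partial1of2 F x t| <= G t.
  by move=> x t _ _; rewrite d1E.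
apply: DeriveDef.
  exact: (@derivable_under_integral _ _ _ mu F setT measurableT b _ _ hI _ hd G G0 IG hG).
rewrite -derive1E.
rewrite (@differentiation_under_integral _ _ _ mu F setT measurableT b _ _ hI _ hd
  G G0 IG hG)//.
by apply: eq_Rintegral => t _; rewrite d1E.
Qed.

Lemma fcos_primitive V : intble mu V -> intble mu (fun t => V t * S t) ->
  primitive_of (fcos V) (fun b => - fsin (fun t => V t * S t) b).
Proof.
move=> IV IVS.
have := @fourier_derive (fun b t => V t * cos (b * S t))
  (fun b t => V t * (- S t * sin (b * S t))) (fun t => `|V t * S t|).
move=> /(_ _ _ _ _)/primitive_of_eq; apply.
- by move=> b; exact: intble_cos.
- by move=> t; exact/primitive_ofZ/primitive_of_cos.
- exact: intble_norm.
- move=> b t; rewrite mulNr mulrN normrN mulrA normrM ler_piMr//; exact: normr_sin.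
- move=> b; rewrite /fsin -[RHS]mulN1r -RintegralZl//; last exact: intble_sin.
  by apply: eq_Rintegral => t _; ring.
Qed.

Lemma fsin_primitive V : intble mu V -> intble mu (fun t => V t * S t) ->
  primitive_of (fsin V) (fcos (fun t => V t * S t)).
Proof.
move=> IV IVS.
have := @fourier_derive (fun b t => V t * sin (b * S t))
  (fun b t => V t * (S t * cos (b * S t))) (fun t => `|V t * S t|).
move=> /(_ _ _ _ _)/primitive_of_eq; apply.
- by move=> b; exact: intble_sin.
- by move=> t; exact/primitive_ofZ/primitive_of_sin.
- exact: intble_norm.
- move=> b t; rewrite mulrA normrM ler_piMr//; exact: normr_cos.
- by move=> b; apply: eq_Rintegral => t _; ring.
Qed.

Variable W : T -> R.
Hypothesis IW : forall k, (k <= 3)%N -> intble mu (fun t => W t * S t ^+ k).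

Let IW0 : intble mu W.
Proof. by apply: eq_integrable (IW (leq0n _)) => // t _ /=; rewrite expr0 mulr1. Qed.
Let IW1 : intble mu (fun t => W t * S t).
Proof. by apply: eq_integrable (IW (isT : 1 <= 3)%N) => // t _ /=; rewrite expr1. Qed.
Let IW2 : intble mu (fun t => W t * S t * S t).
Proof. by apply: eq_integrable (IW (isT : 2 <= 3)%N) => // t _ /=; rewrite expr2 mulrA. Qed.
Let IW3 : intble mu (fun t => W t * S t * S t * S t).
Proof.
by apply: eq_integrable (IW (isT : 3 <= 3)%N) => // t _ /=;
  rewrite !exprS expr0 mulr1 !mulrA.
Qed.

(** Continuity of the second derivative is deduced from its differentiability, which is where the
    moment [k = 3] enters. *)
Lemma C2_fcos : C2 (fcos W).
Proof.
exists (fun b => - fsin (fun t => W t * S t) b).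
exists (fun b => - fcos (fun t => W t * S t * S t) b).
split; [exact: fcos_primitive|exact/primitive_ofN/fsin_primitive|].
exact/primitive_of_continuous/primitive_ofN/fcos_primitive.
Qed.

Lemma C2_fsin : C2 (fsin W).
Proof.
exists (fcos (fun t => W t * S t)), (fun b => - fsin (fun t => W t * S t * S t) b).
split; [exact: fsin_primitive|exact/fcos_primitive|].
exact/primitive_of_continuous/primitive_ofN/fsin_primitive.
Qed.

End fourier_transform.

Section osc_integrable.
Context (R : realType).
Let leb : {measure set (measurableTypeR R) -> \bar R} := @lebesgue_measure R.
Variables (p q : R -> R) (lam : R).
Hypotheses (lam0 : 0 < lam) (C2p : C2 p) (C2q : C2 q).

Lemma osc_indicE t : osc p q lam t =
  \int[leb]_b (\1_`[0, lam] b * (p b * cos (b * t) + q b * sin (b * t))).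
Proof.
rewrite /osc Rintegral_mkcond; apply: eq_Rintegral => b _.
by rewrite patchE indicE; case: ifPn; rewrite ?mul1r ?mul0r.
Qed.

Lemma measurable_joint d (T : measurableType d) (u : T -> R) :
  measurable_fun setT u ->
  measurable_fun setT (fun z : T * measurableTypeR R =>
    \1_`[0, lam] z.2 * (p z.2 * cos (z.2 * u z.1) + q z.2 * sin (z.2 * u z.1))).
Proof.
move=> mu_.
have m2 : measurable_fun setT (fun z : T * measurableTypeR R => z.2 * u z.1).
  apply: measurable_funM; first exact: measurable_snd.
  exact: (measurableT_comp mu_ measurable_fst).
have cm (f : R -> R) : continuous f ->
    measurable_fun setT (fun z : T * measurableTypeR R => f z.2).
  move=> cf; have mf := continuous_measurable_fun cf.
  exact: (measurableT_comp mf measurable_snd).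
apply: measurable_funM.
  have mi := @measurable_indic _ (measurableTypeR R) R setT `[0, lam] (measurable_itv _).
  exact: (measurableT_comp mi measurable_snd).
apply: measurable_funD; apply: measurable_funM.
- exact: (cm _ (C2_continuous C2p)).
- exact: (measurableT_comp (continuous_measurable_fun (@continuous_cos R)) m2).
- exact: (cm _ (C2_continuous C2q)).
- exact: (measurableT_comp (continuous_measurable_fun (@continuous_sin R)) m2).
Qed.

Lemma joint_bound : exists M, forall b t,
  `|\1_`[0, lam] b * (p b * cos (b * t) + q b * sin (b * t))| <= M * \1_`[0, lam] b.
Proof.
have [M M0 hM] := seg_bounded lam (C2_continuous C2p).
have [N N0 hN] := seg_bounded lam (C2_continuous C2q).
exists (M + N) => b t; rewrite indicE; case: (boolP (b \in _)) => [|_]; last first.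
  by rewrite mul0r normr0 mulr0.
rewrite inE/= in_itv/= => bl; rewrite mul1r mulr1 (le_trans (ler_normD _ _))// lerD//.
  by rewrite normrM -[leRHS]mulr1 ler_pM ?hM// normr_cos.
by rewrite normrM -[leRHS]mulr1 ler_pM ?hN// normr_sin.
Qed.

Let Iind (c : R) : intble leb (fun b => c * \1_`[0, lam] b).
Proof.
apply: intbleZl; apply: (@integrable_indic_itv R 0 lam true false).
Qed.


Lemma intble_joint d (T : measurableType d) (mu : {sigma_finite_measure set T -> \bar R})
    (V u : T -> R) : intble mu V -> measurable_fun setT u ->
  intble (mu \x @lebesgue_measure R)%E (fun z => V z.1 *
    (\1_`[0, lam] z.2 * (p z.2 * cos (z.2 * u z.1) + q z.2 * sin (z.2 * u z.1)))).
Proof.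
move=> IV mu_; have [M hM] := joint_bound.
have := intble_prod (intble_norm IV) (Iind M) => /intble_le; apply.
  apply: measurable_funM; last exact: measurable_joint.
  by apply: measurableT_comp => //; exact: intble_measurable IV.
by move=> z; rewrite normrM ler_wpM2l.
Qed.

(* The weight [(1 + t ^+ 2)^-1] makes the integrand integrable on the product, so
   that Fubini's theorem applies. *)
Lemma measurable_osc : measurable_fun setT (osc p q lam).
Proof.
have Ij := @intble_joint _ (measurableTypeR R) (@lebesgue_measure R) _ id
  (@intble_oneDsqrV R) (@measurable_id _ _ _).
have mj := @measurable_Rintegral1 _ _ (measurableTypeR R) (measurableTypeR R) R
  lebesgue_measure lebesgue_measure (fun t b => (1 + t ^+ 2)^-1 *
    (\1_`[0, lam] b * (p b * cos (b * t) + q b * sin (b * t)))) Ij.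
rewrite (_ : osc p q lam = fun t => (1 + t ^+ 2) * \int[lebesgue_measure]_b ((1 + t ^+ 2)^-1 *
    (\1_`[0, lam] b * (p b * cos (b * t) + q b * sin (b * t))))); last first.
  apply/funext => t; rewrite RintegralZl//; last first.
    have [M hM] := joint_bound.
    apply: (intble_le _ _ (Iind M)); last by move=> b; exact: hM.
    have mjt := @measurable_joint _ (measurableTypeR R) (fun=> t) (measurable_cst _).
    have mid := @measurable_id _ (measurableTypeR R) setT.
    exact: (measurableT_comp mjt (measurable_fun_pair mid mid)).
  by rewrite mulVKf ?osc_indicE// gt_eqF// ltr_pwDl// sqr_ge0.
apply: measurable_funM => //.
by apply: measurable_funD => //; exact: measurable_funX.
Qed.

End osc_integrable.

(** * The Fejer kernel *)

Section fejer_kernel.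
Context (R : realType).
Let leb : {measure set (measurableTypeR R) -> \bar R} := @lebesgue_measure R.

(** Half the Fourier transform of the triangle. With this normalization the total mass is pi for
    every [lam], but only the lower bound [cos 1] is established. *)
Definition fejer (lam : R) := osc (fun b => 1 - b / lam) (fun=> 0) lam.

Lemma C2_triangle (lam : R) : C2 (fun b => 1 - b / lam).
Proof.
have := C2D (C2_cst 1) (C2M (C2_id R) (C2_cst (- lam^-1))).
by under eq_fun do rewrite mulrN.
Qed.

Let continuous_triangle_cos (lam t : R) : continuous (fun b : R => (1 - b / lam) * cos (b * t)).
Proof.
move=> x; apply: cvgM; first exact: (C2_continuous (C2_triangle lam)).
exact: (primitive_of_continuous (@primitive_of_cos R t)).
Qed.

Lemma fejerE (lam t : R) :
  fejer lam t = \int[leb]_(b in `[0, lam]) ((1 - b / lam) * cos (b * t)).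
Proof. by apply: eq_Rintegral => b _; rewrite mul0r addr0. Qed.

Lemma fejer_closed (lam t : R) : 0 < lam -> t != 0 ->
  fejer lam t = (1 - cos (lam * t)) / (lam * t ^+ 2).
Proof.
move=> lam0 t0; rewrite fejerE.
have lam_neq0 : lam != 0 by rewrite gt_eqF.
pose G b := (1 - b * lam^-1) * (t^-1 * sin (b * t)) - (lam * t ^+ 2)^-1 * cos (b * t).
have GG : primitive_of G (fun b => (1 - b / lam) * cos (b * t)).
  have D1 : primitive_of (fun b : R => 1 - b * lam^-1) (fun b => 0 - (1 * lam^-1 + b * 0)).
    apply: primitive_ofB; first exact: primitive_of_cst.
    exact: (primitive_ofM (@primitive_of_id R) (@primitive_of_cst R lam^-1)).
  have D2 := primitive_ofZ t^-1 (@primitive_of_sin R t).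
  have D3 := primitive_ofZ (lam * t ^+ 2)^-1 (@primitive_of_cos R t).
  apply: primitive_of_eq (primitive_ofB (primitive_ofM D1 D2) D3) _ => b.
  by field; rewrite lam_neq0.
rewrite (primitive_of_FTC2 (ltW lam0) GG) //.
by rewrite /G !mul0r sin0 cos0; field; rewrite ?lam_neq0 ?t0.
Qed.

Lemma fejer_le (lam t : R) : 0 < lam -> t != 0 ->
  fejer lam t <= 2 / (lam * t ^+ 2).
Proof.
move=> l0 t0; rewrite fejer_closed// ler_wpM2r//.
  by rewrite invr_ge0 mulr_ge0 ?sqr_ge0// ltW.
by have := cos_geN1 (lam * t); lra.
Qed.

Let seg_intble (f : R -> R) (lam : R) : continuous f -> leb.-integrable `[0, lam] (EFin \o f).
Proof.
move=> cf; apply: continuous_compact_integrable; first exact: segment_compact.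
exact: continuous_subspaceT.
Qed.

Lemma Rintegral_triangle (lam : R) : 0 < lam ->
  \int[leb]_(b in `[0, lam]) (1 - b / lam) = lam / 2.
Proof.
move=> lam0; have lam_neq0 : lam != 0 by rewrite gt_eqF.
have D : primitive_of (fun b : R => b - (2 * lam)^-1 * (b * b)) (fun b => 1 - b / lam).
  have D1 := primitive_ofZ (2 * lam)^-1 (primitive_ofM (@primitive_of_id R) (@primitive_of_id R)).
  apply: primitive_of_eq (primitive_ofB (@primitive_of_id R) D1) _ => b.
  by field.
rewrite (primitive_of_FTC2 (ltW lam0) D).
  by field.
exact: (C2_continuous (C2_triangle lam)).
Qed.

(** For [b] in [[0, lam]] one has [|b * t| <= 1], hence [cos (b * t) >= cos 1]; the factor [lam / 2]
    is the area under the triangle. *)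
Lemma fejer_ge_near0 (lam t : R) : 0 < lam -> `|t| <= lam^-1 ->
  cos 1 * (lam / 2) <= fejer lam t.
Proof.
move=> lam0 tl; rewrite fejerE -Rintegral_triangle//.
have It : leb.-integrable `[0, lam] (EFin \o (fun b => 1 - b / lam)).
  exact/seg_intble/C2_continuous/C2_triangle.
rewrite -RintegralZl//; apply: le_Rintegral => //.
- apply: seg_intble => x; apply: cvgM; first exact: cvg_cst.
  exact: (C2_continuous (C2_triangle lam)).
- exact: seg_intble.
- move=> b /=; rewrite in_itv/= => /andP[b0 bl].
  rewrite mulrC ler_wpM2l//.
    by rewrite subr_ge0 ler_pdivrMr// mul1r.
  have bt1 : `|b * t| <= 1.
    rewrite normrM (ger0_norm b0).
    rewrite -(mulfV (lt0r_neq0 lam0)).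
    by rewrite ler_pM.
  have cosn : cos (b * t) = cos `|b * t|.
    by case: (lerP 0 (b * t)) => h; [rewrite ger0_norm|rewrite ltr0_norm// cosN].
  rewrite cosn; move: bt1; rewrite le_eqVlt => /predU1P[->//|bt1].
  have pi1 : 1 <= (pi : R) by have := @pi_ge2 R; lra.
  rewrite ltW// ltr_cos// in_itv/= ?normr_ge0 ?ler01//= ?(le_trans (ltW bt1)) //.
Qed.

Lemma fejer_ge0 (lam t : R) : 0 < lam -> 0 <= fejer lam t.
Proof.
move=> l0; have [->|t0] := eqVneq t 0.
  apply: le_trans (fejer_ge_near0 l0 _); last by rewrite normr0 invr_ge0 ltW.
  by rewrite mulr_ge0 ?(ltW (@cos1_gt0 R))// divr_ge0// ltW.
rewrite fejer_closed//; apply: divr_ge0.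
  by rewrite subr_ge0 cos_le1.
by rewrite mulr_ge0 ?sqr_ge0// ltW.
Qed.

Lemma intble_fejer (lam : R) : 0 < lam -> intble leb (fejer lam).
Proof.
move=> l0.
have [|C C0 hC] := osc_le l0 (C2_triangle lam) (C2_cst 0) _ erefl erefl.
  by rewrite divff ?subrr// gt_eqF.
rewrite /fejer; apply: (@intble_le _ (measurableTypeR R) R leb _ _ _ hC); last first.
  exact/intbleZl/intble_oneDsqrV.
exact: (measurable_osc lam (C2_triangle lam) (C2_cst 0)).
Qed.

Definition fejer_mass lam := \int[leb]_t fejer lam t.

(** The height [cos 1 * (lam / 2)] is attained over an interval of length [2 / lam], so the bound
    does not depend on [lam]. *)
Lemma fejer_mass_ge (lam : R) : 0 < lam -> cos 1 <= fejer_mass lam.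
Proof.
move=> l0.
have li0 : 0 < lam^-1 by rewrite invr_gt0.
have II : intble leb (fun b => (cos 1 * (lam / 2)) * \1_`[(- lam^-1), lam^-1] b).
  by apply: intbleZl; apply: (@integrable_indic_itv R _ _ true false).
have : \int[leb]_b ((cos 1 * (lam / 2)) * \1_`[(- lam^-1), lam^-1] b) <= fejer_mass lam.
  apply: Rintegral_le => //; first exact: intble_fejer.
  move=> x; rewrite indicE; case: (boolP (x \in _)) => [|_].
    rewrite inE/= in_itv/= mulr1 => /andP[h1 h2].
    by apply: fejer_ge_near0 => //; rewrite ler_norml h1 h2.
  by rewrite mulr0 fejer_ge0.
apply: le_trans.
rewrite RintegralZl//; last by apply: (@integrable_indic_itv R _ _ true false).
rewrite /Rintegral integral_indic//= setIT lebesgue_measure_itv/= lte_fin.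
rewrite gtrN// opprK /=.
rewrite le_eqVlt; apply/orP; left; apply/eqP; field.
by rewrite gt_eqF.
Qed.

Lemma fejer_mass_gt0 (lam : R) : 0 < lam -> 0 < fejer_mass lam.
Proof. by move=> l0; apply: lt_le_trans (fejer_mass_ge l0); exact: cos1_gt0. Qed.

Lemma fejer_concentrates (del e : R) : 0 < del -> 0 < e ->
  exists2 lam, 0 < lam &
    \int[leb]_t (fejer lam t * \1_[set t | del < `|t|] t) <= e * fejer_mass lam.
Proof.
move=> d0 e0.
pose J := \int[leb]_t ((1 + t ^+ 2)^-1).
have J0 : 0 <= J.
  by apply: Rintegral_ge0 => x _; rewrite invr_ge0 addr_ge0 ?sqr_ge0.
have c0 : 0 < cos 1 :> R := @cos1_gt0 R.
(* For [|t| > del] the kernel is at most [2 (1 + del^-2) / lam] times [(1 + t^2)^-1], so the outer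
   integral is at most [B / lam]; [lam] brings this below [e * cos 1]. *)
pose B := 2 * (1 + del ^- 2) * J.
have B0 : 0 <= B by rewrite !mulr_ge0// addr_ge0// invr_ge0 exprn_ge0// ltW.
pose lam := (B + 1) / (e * cos 1).
have l0 : 0 < lam by rewrite divr_gt0 ?ltr_wpDl// mulr_gt0.
exists lam => //.
apply: (@le_trans _ _ (e * cos 1)); last by rewrite ler_wpM2l ?fejer_mass_ge// ltW.
apply: (@le_trans _ _ (B / lam)); last first.
  rewrite ler_pdivrMr// /lam mulrCA divff ?mulr1 ?lerDl//.
  by rewrite gt_eqF// mulr_gt0.
rewrite /B mulrAC /J -RintegralZl//; last exact: intble_oneDsqrV.
have md : measurable [set t : R | del < `|t|].
  apply: (@measurable_ltr_set _ (measurableTypeR R) R (fun t => `|t|)).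
  exact: (measurableT_comp (@normr_measurable R setT)).
apply: Rintegral_le.
- by apply: intble_indic => //; exact: intble_fejer.
- exact/intbleZl/intble_oneDsqrV.
- move=> t; rewrite indicE; case: (boolP (t \in _)) => [|_]; last first.
    by rewrite mulr0 !mulr_ge0 ?invr_ge0 ?addr_ge0 ?invr_ge0 ?sqr_ge0 // ltW.
  rewrite inE/= mulr1 => dt.
  have t0 : t != 0 by rewrite -normr_gt0 (lt_trans d0).
  have t2 : 0 < t ^+ 2 by rewrite lt_neqAle eq_sym sqrf_eq0 t0 sqr_ge0.
  apply: (le_trans (fejer_le l0 t0)).
  rewrite ler_pdivlMr ?ltr_wpDr ?sqr_ge0//.
  have -> : 2 / (lam * t ^+ 2) * (1 + t ^+ 2) = 2 * (1 + t ^- 2) / lam.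
    by field; rewrite t0 gt_eqF.
  rewrite ler_wpM2r ?invr_ge0 ?(ltW l0)// ler_wpM2l// lerD2l.
  have d2 : 0 < del ^+ 2 by rewrite exprn_gt0.
  rewrite lef_pV2 ?posrE// -(real_normK (num_real t)).
  by rewrite lerXn2r ?nnegrE ?(ltW d0)// ltW.
Qed.

End fejer_kernel.

(** * A Tauberian theorem *)

Section convolution.
Context d (T : measurableType d) (R : realType) (P : probability T R).
Variables (W S : T -> R).
Hypotheses (mS : measurable_fun setT S) (IW : intble P W).
Let leb : {measure set (measurableTypeR R) -> \bar R} := @lebesgue_measure R.

Let m1 (f : T -> R) : measurable_fun setT f ->
  measurable_fun setT (fun z : T * measurableTypeR R => f z.1).
Proof. by move=> mf; exact: (measurableT_comp mf measurable_fst). Qed.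

Let m2 (f : R -> R) : measurable_fun setT f ->
  measurable_fun setT (fun z : T * measurableTypeR R => f z.2).
Proof. by move=> mf; exact: (measurableT_comp mf measurable_snd). Qed.

Let madd (f : R -> R) : measurable_fun setT f ->
  measurable_fun setT (fun z : T * measurableTypeR R => f (z.2 + S z.1)).
Proof.
move=> mf; apply: (measurableT_comp mf).
by apply: measurable_funD; [exact: (m2 (@measurable_id _ _ _))|exact: m1].
Qed.

Let msub (f : R -> R) : measurable_fun setT f ->
  measurable_fun setT (fun z : T * measurableTypeR R => f (z.2 - S z.1)).
Proof.
move=> mf; apply: (measurableT_comp mf).
by apply: measurable_funB; [exact: (m2 (@measurable_id _ _ _))|exact: m1].
Qed.

(** By translation invariance the integral of [|psi (t + a)|] is [J] for every shift [a], so the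
    double integral of the norm factors. *)
Lemma intble_convolution (psi : R -> R) : intble leb psi ->
  intble (P \x @lebesgue_measure R)%E (fun z => W z.1 * psi (z.2 + S z.1)).
Proof.
move=> Ipsi; have mpsi := intble_measurable Ipsi.
have mW := intble_measurable IW.
have mj : measurable_fun setT
    (EFin \o (fun z : T * measurableTypeR R => W z.1 * psi (z.2 + S z.1))).
  by apply/measurable_EFinP; apply: measurable_funM; [exact: m1|exact: madd].
apply/(integrable12ltyP P (@lebesgue_measure R) mj).
pose J := \int[leb]_t `|psi t|.
have JE a : (\int[leb]_t `|psi (t + a)|%:E)%E = J%:E.
  rewrite /J -(Rintegral_shift a (intble_norm Ipsi)) /Rintegral fineK//.
  exact/integrable_fin_num/intble_norm/intble_shift.
rewrite (eq_integral (fun x => `|W x|%:E * J%:E)%E); last first.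
  move=> x _ /=; rewrite -(JE (S x)) -ge0_integralZl//.
  - by apply: eq_integral => y _; rewrite normrM EFinM.
  - apply/measurable_EFinP/measurableT_comp => //.
    exact: intble_measurable (intble_shift (S x) Ipsi).
rewrite ge0_integralZr//; last 2 first.
- exact/measurable_EFinP/measurableT_comp.
- by rewrite lee_fin; exact: Rintegral_ge0.
rewrite lte_mul_pinfty//.
- exact: integral_ge0.
- rewrite ge0_fin_numE; first by case/integrableP : IW.
  exact: integral_ge0.
- by rewrite ltry.
Qed.

(** Fubini on both sides, with the substitution [r = t + S w] in between. The bound on [psi] makes
    [W w * psi (t + S w)] integrable in [w] for every [t], not just for almost every [t]. *)
Lemma convolution_dual (psi g : R -> R) (K C : R) : intble leb psi ->
  (forall x, `|psi x| <= C) ->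
  measurable_fun setT g -> (forall x, `|g x| <= K) ->
  \int[leb]_t (g t * \int[P]_w (W w * psi (t + S w))) =
  \int[leb]_r (psi r * \int[P]_w (W w * g (r - S w))).
Proof.
move=> Ipsi psiC mg gK; have mpsi := intble_measurable Ipsi.
have mW := intble_measurable IW.
pose f1 (w : T) (t : measurableTypeR R) := g t * (W w * psi (t + S w)).
pose f2 (w : T) (r : measurableTypeR R) := psi r * (W w * g (r - S w)).
have I1 : intble (P \x @lebesgue_measure R)%E (fun z => f1 z.1 z.2).
  have := intbleMr (m2 mg) (fun z => gK z.2) (intble_convolution Ipsi).
  by apply: eq_integrable => // z _ /=; rewrite /f1 mulrC.
have I2 : intble (P \x @lebesgue_measure R)%E (fun z => f2 z.1 z.2).
  have := intbleMr (msub mg) (fun z => gK (z.2 - S z.1)) (intble_prod IW Ipsi).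
  by apply: eq_integrable => // z _ /=; rewrite /f2; congr EFin; ring.
have IWpsi t : intble P (fun w => W w * g (t - S w)).
  apply: intbleMr (fun w => gK (t - S w)) IW.
  by apply: (measurableT_comp mg); exact: measurable_funB.
have IWpsi' t : intble P (fun w => W w * psi (t + S w)).
  apply: intbleMr (fun w => psiC (t + S w)) IW.
  by apply: (measurableT_comp mpsi); exact: measurable_funD.
transitivity (\int[leb]_t \int[P]_w f1 w t).
  by apply: eq_Rintegral => t _; rewrite /f1 RintegralZl.
rewrite -(Rintegral_swap I1).
transitivity (\int[leb]_r \int[P]_w f2 w r); last first.
  by apply: eq_Rintegral => t _; rewrite /f2 RintegralZl.
rewrite -(Rintegral_swap I2).
apply: eq_Rintegral => w _; rewrite /f1 /f2.
have If : intble leb (fun r => psi r * (W w * g (r - S w))).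
  apply: (@intble_le _ (measurableTypeR R) R leb _ (fun r => (`|W w| * K) * `|psi r|)).
  - apply: measurable_funM => //; apply: measurable_funM => //.
    by apply: (measurableT_comp mg); exact: measurable_funB.
  - move=> r; rewrite !normrM mulrC ler_wpM2r// ler_wpM2l//.
  - exact/intbleZl/intble_norm.
rewrite -(Rintegral_shift (S w) If); apply: eq_Rintegral => t _.
by rewrite addrK; ring.
Qed.

End convolution.

Section tauberian.
Context d (T : measurableType d) (R : realType) (P : probability T R).
Variables (W S : T -> R).
Hypotheses (mS : measurable_fun setT S) (W0 : forall t, 0 <= W t).
Hypothesis IW : forall k, (k <= 3)%N -> intble P (fun t => W t * S t ^+ k).
Hypothesis nz : forall b, fcos P S W b ^+ 2 + fsin P S W b ^+ 2 != 0.
Let leb : {measure set (measurableTypeR R) -> \bar R} := @lebesgue_measure R.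

Let IW0 : intble P W.
Proof. by apply: eq_integrable (IW (leq0n _)) => // t _ /=; rewrite expr0 mulr1. Qed.

Let EW := \int[P]_w W w.

Lemma fejer_factor lam : 0 < lam -> exists p q, [/\ C2 p, C2 q,
  [/\ p lam = 0, q lam = 0 & q 0 = 0] &
  forall t, fejer lam t = \int[P]_w (W w * osc p q lam (t + S w))].
Proof.
move=> lam0; pose a := fcos P S W; pose b := fsin P S W.
have C2a : C2 a := C2_fcos mS IW; have C2b : C2 b := C2_fsin mS IW.
pose n x := a x * a x + b x * b x.
have n0 x : n x != 0 by have := nz x; rewrite !expr2.
have C2n : C2 (fun x => (n x)^-1) by apply: C2V => //; apply: C2D; exact: C2M.
have C2k := C2_triangle lam.
(* [p + i q] is the triangle divided by [a - i b = E[W exp (- i x S)]]. *)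
pose p x := (1 - x / lam) * (a x * (n x)^-1).
pose q x := (1 - x / lam) * (b x * (n x)^-1).
have C2p : C2 p by apply: C2M => //; exact: C2M.
have C2q : C2 q by apply: C2M => //; exact: C2M.
exists p, q; split => //.
  rewrite /p /q divff ?gt_eqF// subrr !mul0r; split => //.
  rewrite /b /fsin (_ : \int[P]_t _ = 0) ?mul0r ?mulr0//.
  by apply: Rintegral_eq0 => t; rewrite mul0r sin0 mulr0.
move=> t; rewrite fejerE.
transitivity (\int[P]_w \int[leb]_x (W w * (\1_`[0, lam] x *
    (p x * cos (x * (t + S w)) + q x * sin (x * (t + S w)))))); last first.
  apply: eq_Rintegral => w _; rewrite osc_indicE RintegralZl//.
  have [M hM] := joint_bound lam C2p C2q.
  have Iind : intble leb (fun b => M * \1_`[0, lam] b).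
    by apply: intbleZl; apply: (@integrable_indic_itv R 0 lam true false).
  apply: (@intble_le _ (measurableTypeR R) R leb _ _ _ _ Iind); last by move=> x; exact: hM.
  have mjt := @measurable_joint _ p q lam C2p C2q _ (measurableTypeR R)
    (fun=> t + S w) (measurable_cst _).
  have mid := @measurable_id _ (measurableTypeR R) setT.
  exact: (measurableT_comp mjt (measurable_fun_pair mid mid)).
have mtS : measurable_fun setT (fun w => t + S w) by exact: measurable_funD.
have Ij := intble_joint lam C2p C2q IW0 mtS.
rewrite (@Rintegral_swap _ _ _ _ _ P (@lebesgue_measure R) (fun w x => W w * (\1_`[0, lam] x *
    (p x * cos (x * (t + S w)) + q x * sin (x * (t + S w))))) Ij).
rewrite Rintegral_mkcond; apply: eq_Rintegral => x _.
rewrite patchE indicE; case: (x \in _) => /=; last first.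
  by apply/esym/Rintegral_eq0 => w; rewrite mul0r mulr0.
(* [A] and [B] are the coefficients of [cos (x * S w)] and [sin (x * S w)]. Averaging yields
   [A * a x + B * b x], which is the triangle times [cos (x * t)]: the terms in [sin (x * t)]
   cancel. *)
pose A := p x * cos (x * t) + q x * sin (x * t).
pose B := q x * cos (x * t) - p x * sin (x * t).
transitivity (\int[P]_w (A * (W w * cos (x * S w)) + B * (W w * sin (x * S w)))); last first.
  apply: eq_Rintegral => w _; rewrite mul1r (mulrDr x t (S w)) cosD sinD /A /B; ring.
have Ic := intble_cos mS x IW0; have Is := intble_sin mS x IW0.
rewrite RintegralD//; try exact: intbleZl.
rewrite !RintegralZl// -/(fcos P S W x) -/(fsin P S W x) -/(a x) -/(b x) /A /B /p /q.
have := n0 x; rewrite /n => nx0.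
by field; rewrite nx0 gt_eqF.
Qed.

(** At frequency 0 the nonvanishing hypothesis reads [EW ^+ 2 != 0]. *)
Lemma total_weight_gt0 : 0 < EW.
Proof.
rewrite lt_neqAle Rintegral_ge0// andbT; apply/eqP => EW0.
have := nz 0; rewrite /fsin (_ : \int[P]_t _ = 0); last first.
  by apply: Rintegral_eq0 => t; rewrite mul0r sin0 mulr0.
rewrite /fcos (_ : \int[P]_t _ = EW); last first.
  by apply: eq_Rintegral => t _; rewrite mul0r cos0 mulr1.
by rewrite -EW0 expr0n addr0 eqxx.
Qed.

(** By duality the difference is the integral of [psi r * (A r - 1)], where [A r] is the average of
    [W * g (r - S)]. For [|r| <= L] the second factor is at most [eps]; beyond, it is at most
    [K * EW + 1] and the decay of [psi] makes the integral small. Neither bound involves [g]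
    itself. *)
Lemma tauberian_fejer lam (K e : R) : 0 < lam -> 0 <= K -> 0 < e ->
  exists eps L : R, 0 < eps /\ forall g : R -> R, measurable_fun setT g ->
    (forall x, 0 <= g x <= K) ->
    (forall r, `|r| <= L -> `|\int[P]_w (W w * g (r - S w)) - 1| <= eps) ->
    `|\int[leb]_t (g t * fejer lam t) - fejer_mass lam / EW| <= e.
Proof.
move=> lam0 K0 e0; have EW0 := total_weight_gt0.
have [p [q [C2p C2q [pl ql q0] fejE]]] := fejer_factor lam0.
pose psi := osc p q lam.
have [C C0 psiC] := osc_le lam0 C2p C2q pl ql q0.
have mpsi : measurable_fun setT psi := measurable_osc lam C2p C2q.
have C1 x : `|psi x| <= C.
  apply: le_trans (psiC x) _; rewrite ler_piMr//.
  by rewrite invf_le1 ?ltr_pwDl ?sqr_ge0// lerDl sqr_ge0.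
have Ipsi : intble leb psi.
  apply: (@intble_le _ (measurableTypeR R) R leb _ _ mpsi psiC).
  exact/intbleZl/intble_oneDsqrV.
(* The bound [K + 1] instead of [K] lets [dual] apply to the constant 1 as well; this is how [massE]
   evaluates the integral of [psi]. *)
have dual (g : R -> R) : measurable_fun setT g -> (forall x, 0 <= g x <= K + 1) ->
    \int[leb]_t (g t * fejer lam t) = \int[leb]_r (psi r * \int[P]_w (W w * g (r - S w))).
  move=> mg gK; under eq_Rintegral do rewrite fejE.
  apply: (@convolution_dual _ _ _ _ _ _ mS IW0 _ _ (K + 1) C) => // x.
  by have /andP[g0 ?] := gK x; rewrite ger0_norm.
have massE : fejer_mass lam / EW = \int[leb]_r psi r.
  have := dual (fun=> 1) (measurable_cst _).
  rewrite /fejer_mass; under eq_Rintegral do rewrite mul1r.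
  move=> -> //; last by move=> _; rewrite ler01/= lerDr.
  under eq_Rintegral do under eq_Rintegral do rewrite mulr1.
  by rewrite RintegralZr// mulfK// gt_eqF.
pose J := \int[leb]_r `|psi r|.
have J0 : 0 <= J by exact: Rintegral_ge0.
pose B := (K * EW + 1) * C.
have B0 : 0 <= B by rewrite mulr_ge0// addr_ge0// mulr_ge0// ltW.
have IB : intble leb (fun r => B * (1 + r ^+ 2)^-1).
  exact/intbleZl/intble_oneDsqrV.
have mnorm : measurable_fun setT (fun r : measurableTypeR R => `|r|) :=
  @normr_measurable R setT.
have B0' r : 0 <= B * (1 + r ^+ 2)^-1.
  by rewrite mulr_ge0// invr_ge0 addr_ge0// sqr_ge0.
have e20 : 0 < e / 2 by rewrite divr_gt0.
have [L L0 tailL] := Rintegral_tail IB B0' mnorm e20.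
have {}tailL := tailL _ (lexx L).
exists (e / (2 * (J + 1))), L; split; first by rewrite divr_gt0// mulr_gt0// ltr_wpDl.
move=> g mg gK gL.
have gK1 x : 0 <= g x <= K + 1.
  by have /andP[-> /=] := gK x => /le_trans; apply; rewrite lerDl.
have mgS r : measurable_fun setT (fun w => g (r - S w)).
  by apply: (measurableT_comp mg); exact: measurable_funB.
have IWg r : intble P (fun w => W w * g (r - S w)).
  apply: (intbleMr (c := K) (mgS r) _ IW0) => w.
  by have /andP[g0 ?] := gK (r - S w); rewrite ger0_norm.
pose A r := \int[P]_w (W w * g (r - S w)).
have A0 r : 0 <= A r.
  by apply: Rintegral_ge0 => w _; rewrite mulr_ge0//; have /andP[] := gK (r - S w).
have AK r : A r <= K * EW.
  rewrite /EW -RintegralZl//; apply: Rintegral_le => //; first exact: intbleZl.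
  by move=> w; rewrite mulrC ler_wpM2r//; have /andP[] := gK (r - S w).
have mA : measurable_fun setT A.
  have mf : measurable_fun setT (fun z : measurableTypeR R * T => W z.2 * g (z.1 - S z.2)).
    apply: measurable_funM.
      exact: (measurableT_comp (intble_measurable IW0) measurable_snd).
    apply: (measurableT_comp mg); apply: measurable_funB; first exact: measurable_fst.
    exact: (measurableT_comp mS measurable_snd).
  apply: measurableT_comp => //.
  apply: (@measurable_fun_fubini_tonelli_F _ _ (measurableTypeR R) T R P
    (fun z => (W z.2 * g (z.1 - S z.2))%:E)); first exact/measurable_EFinP.
  by move=> z; rewrite lee_fin mulr_ge0//; have /andP[] := gK (z.1 - S z.2).
have IpsiA : intble leb (fun r => psi r * A r).
  apply: (@intbleMr _ (measurableTypeR R) R leb (K * EW) psi A mA _ Ipsi) => r.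
  by rewrite ger0_norm.
rewrite dual// massE -RintegralB//.
have II : intble leb (fun r => e / (2 * (J + 1)) * `|psi r| +
    B * (1 + r ^+ 2)^-1 * \1_[set r | L < `|r|] r).
  apply: intbleD; first exact/intbleZl/intble_norm.
  by apply: intble_indic => //; exact: measurable_ltr_set.
apply: (le_trans (Rintegral_norm_le _ II _)); first exact: intbleB.
  move=> r; rewrite -[X in _ - X]mulr1 -mulrBr normrM.
  case: (indic_cases R [set t | L < `|t|] r) => -[/= Lr ->].
    rewrite mulr1; apply: ler_wpDl.
      by rewrite mulr_ge0// divr_ge0 ?(ltW e0)// mulr_ge0// addr_ge0.
    rewrite /B -mulrA mulrC; apply: ler_pM => //.
    by rewrite -/(A r) (le_trans (ler_normB _ _))// normr1 lerD2r ger0_norm.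
  rewrite mulr0 addr0 mulrC ler_wpM2r//.
  by apply: gL; rewrite leNgt; exact/negP.
rewrite RintegralD//; last 2 first.
- exact/intbleZl/intble_norm.
- by apply: intble_indic => //; exact: measurable_ltr_set.
rewrite [leRHS](splitr e) lerD//.
rewrite RintegralZl//; last exact: intble_norm.
rewrite -/J invfM mulrA -mulrA ler_piMr ?divr_ge0 ?(ltW e0)//.
by rewrite mulrC ler_pdivrMr ?ltr_wpDl// mul1r lerDl.
Qed.

(** The fejer averages of [g] near 0 are known up to a small error; monotonicity of
    [exp (- al t) g t] turns them into bounds on the single value [g 0]. It is assumed on [[-1, 1]]
    only, because it fails for a truncated [g] at the edge of its window. *)
Lemma tauberian_point (al K e : R) : 0 <= al -> 0 <= K -> 0 < e ->
  exists eps L : R, 0 < eps /\ forall g : R -> R, measurable_fun setT g ->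
    (forall x, 0 <= g x <= K) ->
    (forall x y, -1 <= x -> x <= y -> y <= 1 ->
      expR (- al * y) * g y <= expR (- al * x) * g x) ->
    (forall r, `|r| <= L -> `|\int[P]_w (W w * g (r - S w)) - 1| <= eps) ->
    `|g 0 - EW^-1| <= e.
Proof.
move=> al0 K0 e0; have EW0 := total_weight_gt0.
pose c := EW^-1; have c0 : 0 <= c by rewrite invr_ge0 ltW.
(* The denominator dominates the error terms of both final estimates: [2 c + e + 1 + tau] for the
   upper one, and [1 + c + K] for the lower one. *)
pose tau := e / (3 + 2 * c + e + K).
have den0 : 0 < 3 + 2 * c + e + K by lra.
have tau0 : 0 < tau by rewrite divr_gt0.
have tauE : tau * (3 + 2 * c + e + K) = e by rewrite /tau mulfVK// gt_eqF.
have tau1 : tau < 1 by rewrite ltr_pdivrMr//; lra.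
(* [2 * del <= 1] keeps the compared points in [[-1, 1]], and [2 * al * del <= ln (1 + tau)] limits
   the loss to a factor [1 + tau]; the [+ 1] covers [al = 0]. *)
pose del := Num.min (2^-1) (ln (1 + tau) / (2 * al + 1)).
have ln0 : 0 < ln (1 + tau) by rewrite ln_gt0// ltrDl.
have a1 : 0 < 2 * al + 1 by lra.
have del0 : 0 < del by rewrite lt_min invr_gt0 ltr0n/= divr_gt0.
have delh : del <= 2^-1 by rewrite ge_min lexx.
have edel : expR (al * (2 * del)) <= 1 + tau.
  rewrite -[leRHS]lnK ?posrE ?addr_gt0// ler_expR.
  have : del <= ln (1 + tau) / (2 * al + 1) by rewrite ge_min lexx orbT.
  rewrite ler_pdivlMr// => h.
  by apply: le_trans h; rewrite mulrDr mulr1; nra.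
have [lam lam0 conc] := fejer_concentrates del0 tau0.
pose M := fejer_mass lam; have M0 : 0 < M := fejer_mass_gt0 lam0.
have [eps [L [eps0 H]]] := tauberian_fejer lam0 K0 (mulr_gt0 tau0 M0).
(* [L + 1] leaves room for translating [g] by [a] with [|a| <= 1]. *)
exists eps, (L + 1); split => // g mg gK gmon gL.
have g00 x : 0 <= g x by have /andP[] := gK x.
have Hs a : `|a| <= 1 -> `|\int[leb]_t (g (t + a) * fejer lam t) - M / EW| <= tau * M.
  move=> a1'; apply: (H (fun t => g (t + a))).
  - by apply: (measurableT_comp mg); exact: measurable_funD.
  - by move=> x; exact: gK.
  - move=> r rL; under eq_Rintegral do rewrite addrAC.
    by apply: gL; rewrite (le_trans (ler_normD _ _))// lerD.
have md : measurable [set t : R | del < `|t|].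
  exact: (@measurable_ltr_set _ (measurableTypeR R) R _ _ (@normr_measurable R setT)).
have IF := intble_fejer lam0.
have IFi := @intble_indic _ (measurableTypeR R) R leb (fejer lam) _ md IF.
have F0 t : 0 <= fejer lam t by exact: fejer_ge0.
have IgF a : intble leb (fun t => g (t + a) * fejer lam t).
  have mga : measurable_fun setT (fun t : measurableTypeR R => g (t + a)).
    by apply: (measurableT_comp mg); exact: measurable_funD.
  have := @intbleMr _ (measurableTypeR R) R leb K (fejer lam) (fun t => g (t + a)) mga.
  move=> /(_ _ IF)/eq_integrable; apply => //.
    by move=> t _ /=; rewrite mulrC.
  by move=> t; have /andP[? ?] := gK (t + a); rewrite ger0_norm.
(* On [- 2 del, 0], [g] is at least [g 0 / (1 + tau)], and on [0, 2 del] it is at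
   most [(1 + tau) * g 0]; hence the kernel is centered at [- del] and [del]. *)
have upper : g 0 / (1 + tau) * (M - tau * M) <= M * c + tau * M.
  have hd : `|- del| <= 1 by rewrite normrN gtr0_norm//; lra.
  have /ler_normlP[_ h2] := Hs _ hd.
  apply: (@le_trans _ _ (\int[leb]_t (g (t - del) * fejer lam t))); last first.
    by move: h2; rewrite lerBlDl.
  apply: (@le_trans _ _ (g 0 / (1 + tau) *
    (M - \int[leb]_t (fejer lam t * \1_[set t | del < `|t|] t)))).
    by rewrite ler_wpM2l ?divr_ge0// ?addr_ge0 ?(ltW tau0)// lerB.
  rewrite -RintegralB// -RintegralZl//; last exact: intbleB.
  apply: Rintegral_le; [by apply: intbleZl; exact: intbleB|exact: (IgF (- del))|].
  move=> t; case: (indic_cases R [set t | del < `|t|] t) => -[/= td ->].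
    by rewrite mulr1 subrr mulr0 mulr_ge0.
  rewrite mulr0 subr0 ler_wpM2r//.
  have {}td : `|t| <= del by rewrite leNgt; exact/negP.
  have /ler_normlP[t1 t2] := td.
  have := gmon (t - del) 0; rewrite mulr0 expR0 mul1r => /(_ _ _ _) gm.
  rewrite ler_pdivrMr ?addr_gt0//.
  apply: (le_trans (gm _ _ _)); [lra|lra|lra|].
  rewrite mulrC ler_wpM2l//; apply: le_trans edel; rewrite ler_expR; nra.
have lower : M * c - tau * M <= (1 + tau) * g 0 * M + K * (tau * M).
  have hd : `|del| <= 1 by rewrite gtr0_norm//; lra.
  have /ler_normlP[h1 _] := Hs _ hd.
  apply: (@le_trans _ _ (\int[leb]_t (g (t + del) * fejer lam t))).
    by move: h1; rewrite opprB lerBlDr addrC -lerBlDr.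
  apply: (@le_trans _ _ ((1 + tau) * g 0 * M +
    K * \int[leb]_t (fejer lam t * \1_[set t | del < `|t|] t))).
    rewrite -!RintegralZl// -RintegralD//; try exact: intbleZl.
    apply: Rintegral_le; [exact: IgF|by apply: intbleD; exact: intbleZl|].
    move=> t; case: (indic_cases R [set t | del < `|t|] t) => -[/= td ->].
      rewrite mulr1 ler_wpDl ?mulr_ge0 ?addr_ge0 ?(ltW tau0)// ler_wpM2r//.
      by have /andP[] := gK (t + del).
    rewrite !mulr0 addr0 ler_wpM2r//.
    have {}td : `|t| <= del by rewrite leNgt; exact/negP.
    have /ler_normlP[t1 t2] := td.
    have := gmon 0 (t + del); rewrite mulr0 expR0 mul1r => /(_ _ _ _) gm.
    have {}gm : expR (- al * (t + del)) * g (t + del) <= g 0 by apply: gm; lra.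
    have := ler_wpM2l (expR_ge0 (al * (t + del))) gm.
    rewrite mulrA -expRD mulNr subrr expR0 mul1r => /le_trans; apply.
    rewrite ler_wpM2r//; apply: le_trans edel; rewrite ler_expR; nra.
  by rewrite lerD2l ler_wpM2l.
have {}upper : g 0 * (1 - tau) <= (c + tau) * (1 + tau).
  rewrite -ler_pdivrMr ?addr_gt0// -(ler_pM2r M0).
  move: upper; rewrite mulrAC; nra.
have {}lower : c - tau <= (1 + tau) * g 0 + K * tau.
  by rewrite -(ler_pM2r M0); nra.
rewrite ler_norml -/c; apply/andP; split; nra.
Qed.

End tauberian.

(** * Regular variation *)

(** A positive threshold lets [eventually_mono] assume [0 < x]. *)
Definition eventually_ge (R : realType) (Q : R -> Prop) :=
  exists2 x0 : R, 0 < x0 & forall x, x0 <= x -> Q x.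

Section eventually_ge.
Context (R : realType).
Implicit Types (Q : R -> Prop) (f : R -> R).

Lemma near_eventually Q : (\forall x \near +oo, Q x) -> eventually_ge Q.
Proof.
move=> [M [_ MQ]]; exists (`|M| + 1); first by rewrite ltr_wpDl.
by move=> x Mx; apply: MQ; apply: lt_le_trans Mx; rewrite ltr_pwDr// ler_norm.
Qed.

Lemma eventually_near Q : eventually_ge Q -> \forall x \near +oo, Q x.
Proof.
move=> [x0 _ x0Q]; exists x0; split; first exact: num_real.
by move=> x /ltW; exact: x0Q.
Qed.

Lemma eventually_and Q Q' : eventually_ge Q -> eventually_ge Q' ->
  eventually_ge (fun x => Q x /\ Q' x).
Proof.
move=> [x0 x00 h0] [x1 x10 h1]; exists (Num.max x0 x1).
  by rewrite lt_max x00.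
by move=> x; rewrite ge_max => /andP[/h0 ? /h1 ?].
Qed.

Lemma eventually_mono Q Q' : (forall x, 0 < x -> Q x -> Q' x) ->
  eventually_ge Q -> eventually_ge Q'.
Proof.
move=> QQ' [x0 x00 h]; exists x0 => // x xx0; apply: QQ'; last exact: h.
exact: lt_le_trans xx0.
Qed.

Lemma eventually_mulr (a : R) Q : 0 < a -> eventually_ge Q ->
  eventually_ge (fun x => Q (x * a)).
Proof.
move=> a0 [x0 x00 h]; exists (x0 / a); first by rewrite divr_gt0.
by move=> x; rewrite ler_pdivrMr// => /h.
Qed.

(** Uniformity in [r] comes from [x * expR r >= x * expR (- L)]: a single threshold serves all
    [r]. *)
Lemma eventually_window (L : R) Q : eventually_ge Q ->
  eventually_ge (fun x => forall r, - L <= r -> Q (x * expR r)).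
Proof.
move=> /(eventually_mulr (expR_gt0 (- L))) [x0 x00 h].
have L0 : 0 < expR (- L) by exact: expR_gt0.
exists x0 => // x x0x r Lr.
have -> : x * expR r = (x * expR (r + L)) * expR (- L).
  by rewrite -mulrA -expRD addrK.
apply: h; apply: (le_trans x0x); rewrite ler_peMr//.
  exact: le_trans (ltW x00) x0x.
by rewrite -expR0 ler_expR; lra.
Qed.

Lemma eventually_cvg f (l : R) : f x @[x --> +oo] --> l <->
  forall e, 0 < e -> eventually_ge (fun x => `|f x - l| <= e).
Proof.
split=> [/cvgrPdist_le h e /h /near_eventually|h].
  by apply: eventually_mono => x _; rewrite distrC.
apply/cvgrPdist_le => e /h /eventually_near; apply: filterS => x.
by rewrite distrC.
Qed.

End eventually_ge.

Section regular_variation.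
Context (R : realType) (al : R) (U : R -> R).
Hypotheses (al0 : 0 < al) (U_noninc : {homo U : x y / x <= y >-> y <= x}).
Hypotheses (U_gt0 : forall x, 0 < U x) (RVU : regularly_varying al U).

Lemma RV_ratio (y : R) : 0 < y -> U (x * y) / U x @[x --> +oo] --> y `^ (- al).
Proof.
move=> y0; have := RVU y0; rewrite /asymp_equiv => h.
have p0 : 0 < y `^ (- al) by rewrite powR_gt0.
have := cvgM (cvg_cst (y `^ (- al))) h.
rewrite mulr1 => h1.
have E x : U (x * y) / U x = y `^ (- al) * (U (x * y) / (y `^ (- al) * U x)).
  by field; rewrite !gt_eqF.
by under eq_fun do rewrite E; exact: h1.
Qed.

Lemma RV_le (y c : R) : 0 < y -> y `^ (- al) < c ->
  eventually_ge (fun x => U (x * y) <= c * U x).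
Proof.
move=> y0 yc; have /eventually_cvg/(_ (c - y `^ (- al))) := RV_ratio y0.
rewrite subr_gt0 => /(_ yc); apply: eventually_mono => x _.
by move=> /ler_normlP[_]; rewrite lerD2r ler_pdivrMr.
Qed.

Lemma RV_ge (y c : R) : 0 < y -> c < y `^ (- al) ->
  eventually_ge (fun x => c * U x <= U (x * y)).
Proof.
move=> y0 yc; have /eventually_cvg/(_ (y `^ (- al) - c)) := RV_ratio y0.
rewrite subr_gt0 => /(_ yc); apply: eventually_mono => x _.
by move=> /ler_normlP[+ _]; rewrite opprB lerD2l lerN2 ler_pdivlMr.
Qed.

Lemma dyadic_bracket (v : R) : 1 <= v -> exists n, 2 ^+ n <= v <= 2 ^+ n.+1.
Proof.
move=> v1; have ex : exists n, v <= 2 ^+ n.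
  exists (Num.truncn v).+1; apply: le_trans (ltW (truncnS_gt v)) _.
  by rewrite -natrX ler_nat ltnW// ltn_expl.
(* If the least exponent is 0, then [v = 1] and [n = 0] still works. *)
have := ex_minnP ex => -[[|n] vn minn].
  by exists 0%N; rewrite expr0 v1 expr1 (le_trans vn)// expr0 ler1n.
exists n; rewrite vn andbT leNgt; apply/negP => /ltW /minn.
by rewrite ltnn.
Qed.

(** Past [x2], doubling the argument divides [U] by at most [b = 2^(al + eps)]. From [x / v], with
    [2^n <= v <= 2^(n+1)], [n + 1] doublings reach or pass [x] and cost
    [b^(n+1) <= b * v^(al + eps)]. All of them start at [x / v] or later, hence the condition on
    [x / v]. *)
Lemma potter_bound (eps : R) : 0 < eps -> exists C x2 : R, [/\ 0 <= C, 0 < x2 &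
  forall x v, 1 <= v -> x2 <= x / v -> U (x / v) <= C * v `^ (al + eps) * U x].
Proof.
move=> eps0; pose b : R := 2 `^ (al + eps).
have b0 : 0 < b by rewrite powR_gt0.
have [x2 x20 h2] : eventually_ge (fun x => U x <= b * U (x * 2)).
  have : b^-1 < 2 `^ (- al).
    by rewrite /b -powRN /powR pnatr_eq0/= ltr_expR ltr_pM2r ?ln_gt0 ?ltr1n// ltrN2 ltrDl.
  move=> /(RV_ge (ltr0n R 2)); apply: eventually_mono => x _.
  by rewrite mulrC ler_pdivrMr// mulrC.
exists b, x2; split => //; first exact: ltW.
have iter n y : x2 <= y -> U y <= b ^+ n * U (y * 2 ^+ n).
  elim: n => [|n IH] xy; first by rewrite expr0 mul1r mulr1.
  apply: le_trans (IH xy) _; rewrite exprSr -mulrA ler_wpM2l ?exprn_ge0 ?(ltW b0)//.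
  apply: le_trans (h2 _ _) _.
    apply: le_trans (xy) _; apply: ler_peMr; first exact: ltW (lt_le_trans x20 xy).
    by rewrite exprn_ege1// ler1n.
  by rewrite exprSr mulrA.
move=> x v v1 xv; have [n /andP[nv vn]] := dyadic_bracket v1.
have v0 : 0 < v by exact: lt_le_trans v1.
apply: le_trans (iter n.+1 _ xv) _.
apply: ler_pM; rewrite ?exprn_ge0 ?(ltW b0) ?(ltW (U_gt0 _))//.
  rewrite exprS ler_wpM2l ?(ltW b0)// /b -powR_mulrn ?powR_ge0// -powRrM mulrC.
  rewrite powRrM powR_mulrn ?ler0n//.
  by rewrite ge0_ler_powR ?nnegrE ?exprn_ge0 ?(ltW v0)// addr_ge0// ltW.
apply: U_noninc.
rewrite -{1}(mulfVK (lt0r_neq0 v0) x) ler_wpM2l// ?(ltW vn)//.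
exact: ltW (lt_le_trans x20 xv).
Qed.

Lemma eventually_all (Q : nat -> R -> Prop) n :
  (forall k, eventually_ge (Q k)) -> eventually_ge (fun x => forall k, (k <= n)%N -> Q k x).
Proof.
move=> h; elim: n => [|n IH].
  by apply: eventually_mono (h 0%N) => x _ Q0 k; rewrite leqn0 => /eqP ->.
apply: eventually_mono (eventually_and IH (h n.+1)) => x _ [Qn QS] k.
by rewrite leq_eqVlt => /predU1P[->//|]; exact: Qn.
Qed.

(** Uniform convergence for monotone functions: the pointwise limit is used on the finite grid [t k]
    of mesh [eta], and moving [r] to a neighbouring grid point costs at most a factor
    [expR (al * eta) = 1 + tau]. *)
Lemma RV_locally_uniform (L e : R) : 0 < e -> eventually_ge (fun x =>
  forall r, `|r| <= L -> `|expR (al * r) * U (x * expR r) / U x - 1| <= e).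
Proof.
move=> e0; pose h x r := expR (al * r) * U (x * expR r) / U x.
(* As [tau <= 1], [(1 + tau)^2 <= 1 + 3 tau <= 1 + e]; the lower bound [(1 - tau) / (1 + tau)] is at
   least [1 - 2 tau]. *)
pose tau := Num.min 1 (e / 3).
have tau0 : 0 < tau by rewrite lt_min ltr01/= divr_gt0.
have tau1 : tau <= 1 by rewrite ge_min lexx.
have taue : 3 * tau <= e by rewrite -ler_pdivlMl// mulrC ge_min lexx orbT.
pose eta := ln (1 + tau) / al.
have eta0 : 0 < eta by rewrite divr_gt0// ln_gt0// ltrDl.
have eetaE : expR (al * eta) = 1 + tau.
  by rewrite /eta mulrC mulfVK ?gt_eqF// lnK// posrE addr_gt0.
pose t k := - L + k%:R * eta.
have ev k : eventually_ge (fun x => `|h x (t k) - 1| <= tau).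
  have /eventually_cvg := RV_ratio (expR_gt0 (t k)).
  have := expR_gt0 (al * t k).
  move=> p0 /(_ (tau / expR (al * t k))); rewrite divr_gt0// => /(_ isT).
  have pE : expR (t k) `^ (- al) = (expR (al * t k))^-1.
    by rewrite /powR gt_eqF ?expR_gt0// expRK mulNr expRN.
  apply: eventually_mono => x _; rewrite pE ler_pdivlMr//.
  have -> : h x (t k) - 1 =
      (U (x * expR (t k)) / U x - (expR (al * t k))^-1) * expR (al * t k).
    by rewrite /h; field; rewrite !gt_eqF.
  by rewrite normrM (ger0_norm (ltW p0)).
pose n := Num.truncn (2 * L / eta).
apply: eventually_mono (eventually_all n.+1 ev) => x x0 hk r rL.
have hmono r1 r2 : r1 <= r2 -> h x r2 <= expR (al * (r2 - r1)) * h x r1.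
  move=> r12; rewrite /h !mulrA -expRD -mulrDr subrK ler_wpM2r ?invr_ge0 ?(ltW (U_gt0 _))//.
  rewrite ler_wpM2l ?expR_ge0// U_noninc// ler_wpM2l ?(ltW x0)// ler_expR//.
have h0 r1 : 0 <= h x r1 by rewrite /h !mulr_ge0 ?invr_ge0 ?expR_ge0 ?(ltW (U_gt0 _)).
have /ler_normlP[r1 r2] := rL.
pose k := Num.truncn ((r + L) / eta).
have rLe0 : 0 <= (r + L) / eta by rewrite divr_ge0// ?(ltW eta0)//; lra.
have kn : (k <= n)%N.
  by rewrite le_truncn// ler_wpM2r ?invr_ge0 ?(ltW eta0)//; lra.
have tk : t k <= r.
  have := truncn_le ((r + L) / eta); rewrite rLe0 ler_pdivlMr// => h1.
  by rewrite /t /k; lra.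
have tk1 : r <= t k.+1.
  have := truncnS_gt ((r + L) / eta); rewrite ltr_pdivrMr// => h1.
  by rewrite /t /k; lra.
have dt : t k.+1 - t k = eta by rewrite /t -natr1; ring.
have /ler_normlP[_ a1] := hk k (leqW kn).
have /ler_normlP[a2 _] := hk k.+1 kn.
have u1 : h x r <= (1 + tau) * h x (t k).
  apply: le_trans (hmono _ _ tk) _; rewrite ler_wpM2r// -eetaE ler_expR.
  rewrite ler_wpM2l ?(ltW al0)//.
  by lra.
have u2 : h x (t k.+1) <= (1 + tau) * h x r.
  apply: le_trans (hmono _ _ tk1) _; rewrite ler_wpM2r// -eetaE ler_expR.
  rewrite ler_wpM2l ?(ltW al0)//.
  by lra.
rewrite -/(h x r); have := h0 (t k); have := h0 r.
move: u1 u2 a1 a2; move: (h x r) (h x (t k)) (h x (t k.+1)) => A B C u1 u2 a1 a2 A0 B0.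
rewrite ler_norml; apply/andP; split; nra.
Qed.

End regular_variation.

(** * Multiplicative convolutions with a regularly varying tail *)

Section mellin_convolution.
Context d (T : measurableType d) (R : realType) (P : probability T R).
Variables (Y : T -> R) (al eps C1 : R) (F U : R -> R).
Hypotheses (mY : measurable_fun setT Y) (al0 : 0 < al) (eps0 : 0 < eps).
Hypotheses (F_noninc : {homo F : x y / x <= y >-> y <= x}).
Hypotheses (F_gt0 : forall x, 0 < F x) (F_le1 : forall x, F x <= 1).
Hypotheses (U_noninc : {homo U : x y / x <= y >-> y <= x}).
Hypotheses (U_gt0 : forall x, 0 < U x) (RVU : regularly_varying al U).
Hypotheses (C10 : 0 < C1) (FU : eventually_ge (fun x => F x <= C1 * U x)).
Hypotheses (IZ : intble P (fun t => Y t `^ (al + eps))).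
Hypothesis (GF : tail P Y x / F x @[x --> +oo] --> (0 : R)).

Let mY1 (M : R) : measurable [set t | M < Y t].
Proof. exact: measurable_ltr_set. Qed.

Lemma tail_Rintegral x : tail P Y x = \int[P]_t \1_[set t | x < Y t] t.
Proof. by rewrite /tail /Rintegral integral_indic// setIT. Qed.

(** [P[Y > x / a]] is small compared with [F (x / a)], which is at most [C1 * U (x / a)], and
    regular variation compares this with [U x]. *)
Lemma tail_negligible (a e : R) : 0 < a -> 0 < e ->
  eventually_ge (fun x => tail P Y (x / a) <= e * U x).
Proof.
move=> a0 e0; pose c := a^-1 `^ (- al) + 1.
have ai0 : 0 < a^-1 by rewrite invr_gt0.
have c0 : 0 < c by rewrite ltr_wpDl// powR_ge0.
have ec0 : 0 < e / (c * C1) by rewrite divr_gt0// mulr_gt0.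
have h1 := eventually_mulr ai0 ((eventually_cvg _ _).1 GF _ ec0).
have h2 := eventually_mulr ai0 FU.
have h3 : eventually_ge (fun x => U (x / a) <= c * U x).
  by apply: (RV_le U_gt0 RVU) => //; rewrite /c ltrDl.
apply: eventually_mono (eventually_and h1 (eventually_and h2 h3)) => x _ [+ [k2 k3]].
rewrite subr0 => /ler_normlP[_]; rewrite ler_pdivrMr// => k1.
apply: le_trans k1 _; rewrite -ler_pdivlMl ?mulr_gt0//.
apply: (le_trans k2); rewrite -ler_pdivlMl//.
apply: (le_trans k3); rewrite le_eqVlt; apply/orP; left; apply/eqP.
by field; rewrite !gt_eqF.
by rewrite invr_gt0 mulr_gt0.
Qed.

(* The indicator discards [Y t <= 0]; in particular [x / 0 = 0] is never used. *)
Definition mellin_kernel x t := \1_[set t | 0 < Y t] t * F (x / Y t).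
Local Notation H := mellin_kernel.

Lemma mellin_kernel_ge0 x t : 0 <= H x t.
Proof. by rewrite /H mulr_ge0// ltW. Qed.

Lemma mellin_kernel_le1 x t : H x t <= 1.
Proof.
rewrite /H; case: (indic_cases R [set t | 0 < Y t] t) => -[_ ->].
  by rewrite mul1r.
by rewrite mul0r.
Qed.

Lemma measurable_mellin_kernel x : measurable_fun setT (H x).
Proof.
rewrite (_ : H x = fun t => \1_[set t | 0 < Y t] t * F (x * expR (- ln (Y t)))); last first.
  apply/funext => t; rewrite /H; case: (indic_cases R [set t | 0 < Y t] t) => -[/= Y0 ->].
    by rewrite expRN lnK.
  by rewrite !mul0r.
apply: measurable_funM; first exact: measurable_indic.
apply: measurableT_comp; first exact: nonincreasing_measurable.
apply: measurable_funM => //.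
apply: (measurableT_comp (continuous_measurable_fun (@continuous_expR R))).
apply: (measurableT_comp (@oppr_measurable R setT)).
exact: (measurableT_comp (@measurable_ln R) mY).
Qed.

Lemma intble_mellin_kernel x : intble P (H x).
Proof.
apply: (@intble_bounded _ _ _ _ 1); first exact: measurable_mellin_kernel.
by move=> t; rewrite ger0_norm ?mellin_kernel_ge0// mellin_kernel_le1.
Qed.

(* Potter's bound applies to [x / Y] only while [x / Y >= x3]; for larger [Y] the
   tail of [Y] itself is negligible. *)
Lemma mellin_tail_large (e : R) : 0 < e -> exists2 M0, 1 <= M0 & forall M, M0 <= M ->
  eventually_ge (fun x => \int[P]_t (H x t * \1_[set t | M < Y t] t) <= e * U x).
Proof.
move=> e0; have [C [x2 [C0 x20 hpot]]] := potter_bound al0 U_noninc U_gt0 RVU eps0.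
have [x1 x10 hFU] := FU.
pose x3 := Num.max x1 x2; have x30 : 0 < x3 by rewrite lt_max x10.
pose Z t := Y t `^ (al + eps).
have Z0 t : 0 <= Z t by exact: powR_ge0.
pose D := C1 * C.
have D0 : 0 <= D by rewrite mulr_ge0// ltW.
have e1 : 0 < e / (2 * (D + 1)) by rewrite divr_gt0// mulr_gt0// ltr_wpDl.
have [L L0 hL] := Rintegral_tail IZ Z0 mY e1.
exists (Num.max 1 L); first by rewrite le_max lexx.
move=> M; rewrite ge_max => /andP[M1 LM].
have e2 : 0 < e / 2 by rewrite divr_gt0.
apply: eventually_mono (tail_negligible x30 e2) => x x0 htail.
have IZM : intble P (fun t => Z t * \1_[set t | M < Y t] t) by exact: intble_indic.
have I1 : intble P (\1_[set t | x / x3 < Y t] : T -> R).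
  by apply: (@intble_bounded _ _ _ _ 1) => // t; exact: normr_indic_le1.
apply: (@le_trans _ _ (\int[P]_t (D * U x * (Z t * \1_[set t | M < Y t] t) +
  \1_[set t | x / x3 < Y t] t))).
  apply: Rintegral_le.
  - by apply: intble_indic => //; exact: intble_mellin_kernel.
  - by apply: intbleD => //; exact: intbleZl.
  - move=> t; case: (indic_cases R [set t | M < Y t] t) => -[/= hM ->]; last first.
      by rewrite !mulr0 add0r.
    have Y1 : 1 < Y t by exact: le_lt_trans hM.
    have Y0 : 0 < Y t by exact: lt_trans Y1.
    rewrite !mulr1; case: (indic_cases R [set t | x / x3 < Y t] t) => -[/= hx ->].
      by rewrite ler_wpDl ?mellin_kernel_le1// !mulr_ge0// ltW.
    rewrite addr0 /H indicE mem_set//= mul1r.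
    have xY : x3 <= x / Y t.
      by rewrite ler_pdivlMr// mulrC -ler_pdivlMr// leNgt; exact/negP.
    apply: le_trans (hFU _ _) _; first by apply: le_trans xY; rewrite le_max lexx.
    rewrite /D -!mulrA ler_wpM2l ?(ltW C10)//.
    have := hpot x (Y t) (ltW Y1) => /(_ _)/le_trans; apply.
      by apply: le_trans xY; rewrite le_max lexx orbT.
    by rewrite /Z -mulrA [U x * _]mulrC.
rewrite RintegralD//; last exact: intbleZl.
rewrite RintegralZl// -tail_Rintegral (splitr e) mulrDl lerD//.
have hLM := hL M LM.
apply: (@le_trans _ _ (D * U x * (e / (2 * (D + 1))))).
  by apply: ler_wpM2l => //; apply: mulr_ge0 => //; exact: ltW.
rewrite mulrAC ler_wpM2r ?(ltW (U_gt0 _))//.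
have D1 : 0 < 2 * (D + 1) by rewrite mulr_gt0// ltr_wpDl.
rewrite mulrA ler_pdivrMr// (_ : e / 2 * (2 * (D + 1)) = D * e + e); last by field.
by rewrite lerDl ltW.
Qed.

(** If [Y < 1 / M], then [x / Y >= x * M], and [F (x * M) <= C1 * U (x * M)] is of order
    [C1 * M^(- al) * U x]; the bound is pointwise in [t]. *)
Lemma mellin_tail_small (e : R) : 0 < e -> exists2 M0, 1 <= M0 & forall M, M0 <= M ->
  eventually_ge (fun x => forall t, H x t * \1_[set t | Y t < M^-1] t <= e * U x).
Proof.
(* [M >= M0] gives [M^al >= 1 + C1 / e], hence [M^(- al) < e / C1]. *)
move=> e0; pose M0 : R := (1 + C1 / e) `^ al^-1 + 1.
have M01 : 1 <= M0 by rewrite lerDr powR_ge0.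
exists M0 => // M M0M.
have M0' : 0 < M by apply: lt_le_trans M0M; apply: lt_le_trans M01.
have ce0 : 0 < C1 / e by rewrite divr_gt0.
have hM : M `^ (- al) < e / C1.
  rewrite powRN -[e / C1]invf_div ltf_pV2 ?posrE ?powR_gt0//.
  apply: (@lt_le_trans _ _ (1 + C1 / e)); first by rewrite ltrDr.
  have -> : 1 + C1 / e = ((1 + C1 / e) `^ al^-1) `^ al.
    by rewrite -powRrM mulVf ?lt0r_neq0// powRr1// addr_ge0 ?ltW.
  apply: ge0_ler_powR; rewrite ?nnegrE ?powR_ge0 ?(ltW al0) ?(ltW M0')//.
  by apply: le_trans M0M; rewrite /M0 lerDl.
have h1 := eventually_mulr M0' FU.
have h2 := RV_le U_gt0 RVU M0' hM.
apply: eventually_mono (eventually_and h1 h2) => x x0 [k1 k2] t.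
have eU : 0 <= e * U x by rewrite mulr_ge0// ltW.
case: (indic_cases R [set t | Y t < M^-1] t) => -[/= YM ->]; last by rewrite mulr0.
rewrite mulr1 /H; case: (indic_cases R [set t | 0 < Y t] t) => -[/= Y0 ->]; last first.
  by rewrite mul0r.
rewrite mul1r; apply: (@le_trans _ _ (F (x * M))).
  apply: F_noninc; rewrite ler_wpM2l ?(ltW x0)//.
  by rewrite -[M]invrK lef_pV2 ?posrE ?invr_gt0// ltW.
apply: (le_trans k1); rewrite -ler_pdivlMl//; apply: (le_trans k2).
by rewrite le_eqVlt; apply/orP; left; apply/eqP; field; rewrite gt_eqF.
Qed.

Lemma mellin_tail (e : R) : 0 < e -> exists2 L, 0 <= L &
  eventually_ge (fun x => \int[P]_t (H x t * \1_[set t | L < `|ln (Y t)|] t) <= e * U x).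
Proof.
move=> e0; have e2 : 0 < e / 2 by rewrite divr_gt0.
have [M1 M11 h1] := mellin_tail_large e2.
have [M2 M21 h2] := mellin_tail_small e2.
pose M := Num.max M1 M2.
have M1M : M1 <= M by rewrite le_max lexx.
have M2M : M2 <= M by rewrite le_max lexx orbT.
have M1' : 1 <= M by exact: le_trans M1M.
have M0 : 0 < M by exact: lt_le_trans M1'.
exists (ln M); first by rewrite ln_ge0.
apply: eventually_mono (eventually_and (h1 _ M1M) (h2 _ M2M)) => x x0 [k1 k2].
have mln : measurable [set t | ln M < `|ln (Y t)|].
  apply: measurable_ltr_set; apply: measurableT_comp => //.
  exact: (measurableT_comp (@measurable_ln R) mY).
have I1 := intble_indic (mY1 M) (intble_mellin_kernel x).
apply: (@le_trans _ _ (\int[P]_t (H x t * \1_[set t | M < Y t] t + e / 2 * U x))).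
  apply: Rintegral_le.
  - by apply: intble_indic => //; exact: intble_mellin_kernel.
  - by apply: intbleD => //; exact: finite_measure_integrable_cst.
  - move=> t; have := k2 t.
    have H0 := mellin_kernel_ge0 x t.
    have eU : 0 <= e / 2 * U x by rewrite mulr_ge0// ltW.
    have a1 : 0 <= H x t * \1_[set t | M < Y t] t by rewrite mulr_ge0.
    case: (indic_cases R [set t | ln M < `|ln (Y t)|] t) => -[/= hL ->]; last first.
      by move=> _; rewrite mulr0 addr_ge0.
    (* For [Y t <= 0] the value of [ln (Y t)] is a default, but the kernel vanishes. *)
    rewrite mulr1; have [Y0|Y0] := lerP (Y t) 0.
      move=> _; rewrite {1}/H; case: (indic_cases R [set t | 0 < Y t] t) => -[/= Y0' ->].
        by have := lt_le_trans Y0' Y0; rewrite ltxx.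
      by rewrite mul0r addr_ge0.
    case: (indic_cases R [set t | M < Y t] t) => -[/= hM ->].
      by move=> _; rewrite mulr1 lerDl.
    rewrite mulr0 add0r.
    case: (indic_cases R [set t | Y t < M^-1] t) => -[/= hM' ->]; first by rewrite mulr1.
    exfalso; move/negP : hM; rewrite -leNgt => hM; move/negP : hM'; rewrite -leNgt => hM'.
    move: hL; apply/negP; rewrite -leNgt ler_norml -lnV ?posrE// !ler_ln ?posrE ?invr_gt0//.
    by rewrite hM hM'.
rewrite RintegralD//; last exact: finite_measure_integrable_cst.
by rewrite Rintegral_cst_probability [in leRHS](splitr e) mulrDl lerD.
Qed.

(** Where [|ln Y| <= L], the kernel is at most [F (x * expR (- L))], hence [O(U x)]; the rest is
    [mellin_tail]. This bound later absorbs the error [|phi1 - d1| <= eta] integrated over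
    [XY > x]. *)
Lemma mellin_bounded : exists2 C, 0 <= C & eventually_ge (fun x => \int[P]_t H x t <= C * U x).
Proof.
have [L L0 h1] := mellin_tail ltr01.
pose c := expR (- L) `^ (- al) + 1.
have c0 : 0 <= c by rewrite addr_ge0// powR_ge0.
have h2 := eventually_mulr (expR_gt0 (- L)) FU.
have h3 : eventually_ge (fun x => U (x * expR (- L)) <= c * U x).
  by apply: (RV_le U_gt0 RVU); rewrite ?expR_gt0 /c ?ltrDl.
exists (1 + C1 * c); first by rewrite addr_ge0// mulr_ge0// ltW.
apply: eventually_mono (eventually_and h1 (eventually_and h2 h3)) => x x0 [k1 [k2 k3]].
have mln : measurable [set t | L < `|ln (Y t)|].
  apply: measurable_ltr_set; apply: measurableT_comp => //.
  exact: (measurableT_comp (@measurable_ln R) mY).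
have I1 := intble_indic mln (intble_mellin_kernel x).
apply: (@le_trans _ _ (\int[P]_t (H x t * \1_[set t | L < `|ln (Y t)|] t + C1 * c * U x))).
  apply: Rintegral_le.
  - exact: intble_mellin_kernel.
  - by apply: intbleD => //; exact: finite_measure_integrable_cst.
  - move=> t.
    have cU : 0 <= C1 * c * U x by rewrite !mulr_ge0// ltW.
    case: (indic_cases R [set t | L < `|ln (Y t)|] t) => -[/= hL ->].
      by rewrite mulr1 lerDl.
    rewrite mulr0 add0r /H; case: (indic_cases R [set t | 0 < Y t] t) => -[/= Y0 ->];
      last by rewrite mul0r.
    rewrite mul1r; apply: (@le_trans _ _ (F (x * expR (- L)))).
      apply: F_noninc; rewrite ler_wpM2l ?(ltW x0)// expRN lef_pV2 ?posrE ?expR_gt0//.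
      move/negP : hL; rewrite -leNgt => /(le_trans (ler_norm _)).
      by rewrite -ler_expR lnK.
    by apply: (le_trans k2); rewrite -mulrA ler_wpM2l// ltW.
rewrite RintegralD//; last exact: finite_measure_integrable_cst.
rewrite Rintegral_cst_probability mulrDl lerD//.
Qed.

Variables (w : T -> R) (B : R).
Hypotheses (mw : measurable_fun setT w) (w0 : forall t, 0 <= w t) (wB : forall t, w t <= B).

(** The Fourier transform of this weight along [ln Y] is the Mellin transform [E[w Y^(al + i b)]]
    over [Y > 0]. The indicator is needed as [powR] is 1, not 0, at negative arguments. *)
Definition mellin_weight t := w t * (Y t `^ al * \1_[set t | 0 < Y t] t).
Local Notation W := mellin_weight.
Local Notation S := (fun t => ln (Y t)).

Let mS : measurable_fun setT S.
Proof. exact: (measurableT_comp (@measurable_ln R) mY). Qed.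

Let W0 t : 0 <= W t.
Proof. by rewrite !mulr_ge0// powR_ge0. Qed.

Let B0 : 0 <= B.
Proof.
have Iw : intble P w by apply: (@intble_bounded _ _ _ _ B) => // t; rewrite ger0_norm.
rewrite -(Rintegral_cst_probability P B); apply: (@le_trans _ _ (\int[P]_t w t)).
  exact: Rintegral_ge0.
by apply: Rintegral_le => //; exact: finite_measure_integrable_cst.
Qed.

(** [|ln Y|^k] is bounded by a multiple of [exp (g |ln Y|)]. For [Y >= 1] the extra power is
    absorbed since [g <= eps], and for [Y < 1] since [g <= al]. *)
Lemma intble_mellin_weight (k : nat) : (k <= 3)%N -> intble P (fun t => W t * S t ^+ k).
Proof.
move=> k3; pose g := Num.min al eps.
have g0 : 0 < g by rewrite lt_min al0.
have gal : g <= al by rewrite ge_min lexx.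
have geps : g <= eps by rewrite ge_min lexx orbT.
(* [|s| <= (3 / g) * exp (g |s| / 3)]; raised to a power [k <= 3], the exponential stays below
   [exp (g |s|)]. *)
pose C := (3 / g) ^+ k; have C0 : 0 <= C by rewrite exprn_ge0// divr_ge0// ltW.
apply: (@intble_le _ _ _ _ _ (fun t => B * C * (1 + Y t `^ (al + eps)))).
- apply: measurable_funM.
    apply: measurable_funM => //; apply: measurable_funM; last exact: measurable_indic.
    exact: (measurableT_comp (@measurable_powR R al) mY).
  exact: measurable_funX.
- move=> t; rewrite /W; case: (indic_cases R [set t | 0 < Y t] t) => -[/= Y0 ->]; last first.
    by rewrite !mulr0 mul0r normr0 !mulr_ge0// addr_ge0// powR_ge0.
  rewrite mulr1 -mulrA normrM (ger0_norm (w0 t)) -mulrA; apply: ler_pM => //.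
  set s := ln (Y t).
  have sk : `|s| ^+ k <= C * expR (g * `|s|).
    have s1 : `|s| <= 3 / g * expR (g * `|s| / 3).
      have := expR_ge1Dx (g * `|s| / 3) => h.
      rewrite -ler_pdivrMl ?divr_gt0// invf_div.
      by apply: le_trans h; rewrite mulrAC lerDr.
    apply: (@le_trans _ _ ((3 / g * expR (g * `|s| / 3)) ^+ k)).
      by rewrite lerXn2r ?nnegrE// mulr_ge0 ?expR_ge0// divr_ge0// ltW.
    rewrite exprMn ler_wpM2l// -expRM_natl ler_expR.
    have gs : 0 <= g * `|s| by rewrite mulr_ge0// ltW.
    have : k%:R <= 3 :> R by rewrite ler_nat.
    by rewrite mulrA ler_pdivrMr// => h; rewrite mulrC ler_wpM2l.
  rewrite normrM normrX (ger0_norm (powR_ge0 _ _)).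
  apply: (@le_trans _ _ (Y t `^ al * (C * expR (g * `|s|)))).
    by rewrite ler_wpM2l// powR_ge0.
  rewrite mulrCA ler_wpM2l// /powR !gt_eqF// -/s -expRD.
  have [s0|s0] := lerP 0 s.
    rewrite ger0_norm// ler_wpDl// ler_expR -mulrDl ler_wpM2r// lerD2l//.
  rewrite ltr0_norm// mulrN -mulrBl ler_wpDr ?expR_ge0//.
  by rewrite -expR0 ler_expR mulr_ge0_le0 ?subr_ge0// ltW.
- apply/intbleZl/intbleD => //; exact: finite_measure_integrable_cst.
Qed.

Hypothesis nz : forall b, fcos P S W b ^+ 2 + fsin P S W b ^+ 2 != 0.
Hypothesis VU : forall e, 0 < e -> eventually_ge (fun x =>
  `|\int[P]_t (w t * H x t) - U x| <= e * U x).

(** For each large [x], [tauberian_point] is applied to [g], the rescaled tail cut off outside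
    [[- L', L']], whose value at 0 is [F x / U x]. *)
Lemma mellin_tauberian (e : R) : 0 < e ->
  eventually_ge (fun x => `|F x / U x - (\int[P]_t W t)^-1| <= e).
Proof.
(* On the window [g <= C1 * h], and [h <= 1 + eta <= 2]. *)
move=> e0; pose K := 2 * C1; have K0 : 0 <= K by rewrite mulr_ge0// ltW.
have [eps' [L [eps'0 Htaub]]] := tauberian_point mS W0 intble_mellin_weight nz (ltW al0) K0 e0.
pose eta := Num.min 1 (eps' / 3).
have eta0 : 0 < eta by rewrite lt_min ltr01/= divr_gt0.
have eta1 : eta <= 1 by rewrite ge_min lexx.
have etae : 3 * eta <= eps' by rewrite -ler_pdivlMl// mulrC ge_min lexx orbT.
have B1 : 0 < B + 1 by rewrite ltr_wpDl.
have [Lt Lt0 htail] := mellin_tail (divr_gt0 eta0 B1).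
(* The window contains [[-1, 1]], where monotonicity is required; moreover, for [|r| <= L],
   [|r - ln Y| > L'] forces [|ln Y| > Lt], so the truncation error falls under [mellin_tail]. *)
pose L' := `|L| + 1 + Lt.
have L'1 : 1 <= L' by rewrite /L'; have := normr_ge0 L; lra.
have LL' : L + Lt <= L' by rewrite /L'; have := ler_norm L; lra.
have := eventually_window L' htail => h1.
have := eventually_window L' (VU eta0) => h2.
have := eventually_window L' FU => h3.
have h4 := RV_locally_uniform al0 U_noninc U_gt0 RVU L' eta0.
apply: eventually_mono (eventually_and (eventually_and h1 h2) (eventually_and h3 h4)).
move=> x x0 [[k1 k2] [k3 k4]].
have Ux := U_gt0 x.
pose h r := expR (al * r) * U (x * expR r) / U x.
pose g t := \1_`[(- L'), L'] t * (expR (al * t) * F (x * expR t) / U x).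
have win t : `|t| <= L' -> \1_`[(- L'), L'] t = 1 :> R.
  by move=> tL; rewrite indicE mem_set// /= in_itv/= -ler_norml.
have wout t : L' < `|t| -> \1_`[(- L'), L'] t = 0 :> R.
  by move=> tL; rewrite indicE memNset// /= in_itv/= -ler_norml leNgt tL.
have g_win t : `|t| <= L' -> g t = expR (al * t) * F (x * expR t) / U x.
  by move=> /win; rewrite /g => ->; rewrite mul1r.
have g0E : g 0 = F x / U x.
  by rewrite g_win ?normr0 ?(le_trans ler01)// mulr0 expR0 mul1r mulr1.
rewrite -g0E; apply: Htaub.
- apply: measurable_funM; first exact: measurable_indic.
  apply: measurable_funM => //; apply: measurable_funM.
    apply: (measurableT_comp (continuous_measurable_fun (@continuous_expR R))).
    exact: measurable_funM.
  apply: measurableT_comp; first exact: nonincreasing_measurable.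
  apply: measurable_funM => //.
- move=> t; have [tL|tL] := lerP `|t| L'; last by rewrite /g wout// mul0r lexx K0.
  rewrite g_win// mulr_ge0 ?invr_ge0 ?mulr_ge0 ?expR_ge0 ?(ltW (F_gt0 _)) ?(ltW Ux)//=.
  have /ler_normlP[_ k4t] := k4 t tL.
  have k3t : F (x * expR t) <= C1 * U (x * expR t).
    by apply: k3; have /ler_normlP[? _] := tL; lra.
  apply: (@le_trans _ _ (C1 * h t)); last first.
    rewrite /K mulrC ler_wpM2r// ?(ltW C10)//.
    by rewrite /h; lra.
  rewrite /h !mulrA ler_wpM2r ?invr_ge0 ?(ltW Ux)// -mulrA mulrCA ler_wpM2l ?expR_ge0//.
- move=> a b a1 ab b1.
  have aL : `|a| <= L' by apply: le_trans L'1; rewrite ler_norml; apply/andP; split; lra.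
  have bL : `|b| <= L' by apply: le_trans L'1; rewrite ler_norml; apply/andP; split; lra.
  have simp t : `|t| <= L' -> expR (- al * t) * g t = F (x * expR t) / U x.
    by move=> tL; rewrite g_win// !mulrA -expRD mulNr addNr expR0 mul1r.
  rewrite !simp// ler_wpM2r ?invr_ge0 ?(ltW Ux)// F_noninc// ler_wpM2l ?(ltW x0)//.
  by rewrite ler_expR.
- move=> r rL; pose xr := x * expR r.
  have rL' : `|r| <= L' by apply: (le_trans rL); lra.
  have rL'' : - L' <= r by have /ler_normlP[? _] := rL'; lra.
  have mE : measurable [set t | L' < `|r - ln (Y t)|].
    by apply: measurable_ltr_set; apply: measurableT_comp => //; exact: measurable_funB.
  have mE' : measurable [set t | Lt < `|ln (Y t)|].
    by apply: measurable_ltr_set; exact: measurableT_comp.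
  have IH := intble_mellin_kernel xr.
  have IwH : intble P (fun t => w t * H xr t).
    have := intbleMr (c := B) mw _ IH => /(_ _)/eq_integrable; apply => //.
      by move=> t _ /=; rewrite mulrC.
    by move=> t; rewrite ger0_norm.
  have IwE := intble_indic mE IwH.
  have E : \int[P]_t (W t * g (r - ln (Y t))) = expR (al * r) / U x *
      (\int[P]_t (w t * H xr t) -
       \int[P]_t (w t * H xr t * \1_[set t | L' < `|r - ln (Y t)|] t)).
    rewrite -RintegralB// -RintegralZl//; last exact: intbleB.
    apply: eq_Rintegral => t _; rewrite /W /H.
    case: (indic_cases R [set t | 0 < Y t] t) => -[/= Y0 ->]; last first.
      by rewrite !(mulr0, mul0r) subrr mulr0.
    case: (indic_cases R [set t | L' < `|r - ln (Y t)|] t) => -[/= hL ->].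
      by rewrite /g wout// mul0r !mulr0 mulr1 subrr mulr0.
    rewrite g_win; last by rewrite leNgt; exact/negP.
    rewrite mulr0 subr0 mulr1 mul1r.
    have -> : x * expR (r - ln (Y t)) = xr / Y t by rewrite expRD expRN lnK// mulrA.
    rewrite /powR gt_eqF// mulrBr expRB.
    by field; rewrite !gt_eqF ?expR_gt0.
  pose Er := \int[P]_t (w t * H xr t * \1_[set t | L' < `|r - ln (Y t)|] t).
  have Er0 : 0 <= Er.
    apply: Rintegral_ge0 => t _; apply: mulr_ge0 => //; apply: mulr_ge0 => //.
    exact: mellin_kernel_ge0.
  have Er1 : Er <= eta * U xr.
    have IHE := intble_indic mE' IH.
    apply: (@le_trans _ _ (B * \int[P]_t (H xr t * \1_[set t | Lt < `|ln (Y t)|] t))).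
      rewrite -RintegralZl//; apply: Rintegral_le => //; first exact: intbleZl.
      move=> t; rewrite -mulrA; apply: ler_pM => //.
        by apply: mulr_ge0 => //; exact: mellin_kernel_ge0.
      rewrite ler_wpM2l ?mellin_kernel_ge0//.
      case: (indic_cases R [set t | L' < `|r - ln (Y t)|] t) => -[/= hL ->]; last by [].
      rewrite indicE mem_set//=.
      have := ler_normB r (ln (Y t)); lra.
    apply: (@le_trans _ _ (B * (eta / (B + 1) * U xr))).
      by rewrite ler_wpM2l//; exact: k1.
    rewrite mulrA ler_wpM2r ?(ltW (U_gt0 _))// mulrA ler_pdivrMr// mulrC.
    rewrite ler_wpM2l ?(ltW eta0)//.
    by rewrite lerDl.
  have Uxr := U_gt0 xr.
  have k2r := k2 r rL''; have k4r := k4 r rL'.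
  rewrite E -/Er.
  pose v := (\int[P]_t (w t * H xr t)) / U xr; pose er := Er / U xr.
  (* [h r] and [v] are within [eta] of 1 and [0 <= er <= eta <= 1], so [h r * (v - er)] is within
     [3 * eta] of 1. *)
  have -> : expR (al * r) / U x * (\int[P]_t (w t * H xr t) - Er) = h r * (v - er).
    by rewrite /h /v /er -/xr; field; rewrite !gt_eqF.
  have er0 : 0 <= er by rewrite divr_ge0// ltW.
  have er1 : er <= eta by rewrite ler_pdivrMr.
  have v1 : `|v - 1| <= eta.
    rewrite -(ler_pM2r Uxr) -{1}(ger0_norm (ltW Uxr)) -normrM mulrBl mul1r /v mulfVK ?gt_eqF//.
  have h1' : `|h r - 1| <= eta by [].
  move: v1 h1' => /ler_normlP[v1 v2] /ler_normlP[h1' h2'].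
  move: (h r) er0 er1 v1 v2 h1' h2' => hr; move: v er => {}v {}er er0 er1 v1 v2 h1' h2'.
  apply: le_trans etae; rewrite ler_norml; apply/andP; split; nra.
Qed.

End mellin_convolution.

(** * Sarmanov pairs *)

Section support.
Context d (T : measurableType d) (R : realType) (P : probability T R).
Variable X : {RV P >-> R}.

(** A point off the support lies in a ball of rational centre and radius [1 / (n + 1)] that the law
    of [X] does not charge; there are countably many such balls. *)
Lemma ae_support : {ae P, forall t, Defs.support X (X t)}.
Proof.
pose U k := if @unpickle (rat * nat)%type k is Some (q, n) then
  if distribution P X (ball (ratr q : R) n.+1%:R^-1) == 0%E
  then X @^-1` ball (ratr q : R) n.+1%:R^-1 else set0 else set0.
have UN k : P.-negligible (U k).
  rewrite /U; case: unpickle => [[q n]|]; last exact: negligible_set0.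
  case: ifPn => [/eqP X0|_]; last exact: negligible_set0.
  apply/negligibleP => //.
  by rewrite -[X in measurable X]setTI; apply: measurable_funPT => //; exact: measurable_ball.
apply: negligibleS (negligible_bigcup UN) => t /= /existsNP[e /not_implyP[e0 /negP]].
rewrite -leNgt => Xe.
(* The radius is below [e / 2], so a rational ball containing [X t] lies inside [ball (X t) e]. *)
pose n := Num.truncn (2 / e).
have n1 : n.+1%:R^-1 < e / 2.
  by rewrite invf_plt ?posrE ?divr_gt0// invf_div; exact: truncnS_gt.
have n0 : 0 < n.+1%:R^-1 :> R by rewrite invr_gt0.
have /rat_in_itvoo[q] : X t - n.+1%:R^-1 < X t + n.+1%:R^-1 by rewrite ltrD2l gtrN.
rewrite in_itv/= => /andP[q1 q2].
have qb : ball (ratr q : R) n.+1%:R^-1 (X t).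
  by rewrite /ball/= /ball_ ltr_norml ltrBrDr addrC q1/= ltrBlDr addrC.
have sub : ball (ratr q : R) n.+1%:R^-1 `<=` ball (X t) e.
  move=> y qy; apply: le_ball (ball_triangle (ball_sym qb) qy).
  by rewrite [leRHS]splitr lerD// ltW.
exists (pickle (q, n)); first exact: I.
rewrite /U pickleK ifT; first exact: qb.
rewrite -measure_le0; apply: le_trans Xe.
by apply: le_measure => //; rewrite inE; exact: measurable_ball.
Qed.

Lemma tail_support (M : R) : 0 < tail P X M -> exists2 x, Defs.support X x & M < x.
Proof.
move=> tM; apply: contrapT => h; move: tM; rewrite /tail.
suff -> : P [set t | M < X t] = 0%E by rewrite ltxx.
apply: measure_negligible; first exact: measurable_ltr_set.
by apply: negligibleS ae_support => t /= Mt sX; apply: h; exists (X t).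
Qed.

End support.

Section sarmanov_kernel.
Context d (T : measurableType d) (R : realType) (P : probability T R).
Variables (X Y : {RV P >-> R}).
Local Notation Q := ((distribution P X \x distribution P Y)%E).

Lemma ae_fst (N : set R) : measurable N -> {ae P, forall t, ~ N (X t)} ->
  {ae Q, forall z, ~ N z.1}.
Proof.
move=> mN h; exists (N `*` setT); split.
- exact: measurableX.
- rewrite product_measure1E//.
  transitivity (0 * distribution P Y setT)%E; last by rewrite mul0e.
  congr (_ * _)%E.
  apply: (@measure_negligible _ _ _ P (X @^-1` N)).
    by rewrite -[Z in measurable Z]setTI; exact: (measurable_funPT X).
  by apply: negligibleS h => t /= Nt; apply.
- by move=> z /= /contrapT.
Qed.

Lemma ae_snd (N : set R) : measurable N -> {ae P, forall t, ~ N (Y t)} ->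
  {ae Q, forall z, ~ N z.2}.
Proof.
move=> mN h; exists (setT `*` N); split.
- exact: measurableX.
- rewrite product_measure1E//.
  transitivity (distribution P X setT * 0)%E; last by rewrite mule0.
  congr (_ * _)%E.
  apply: (@measure_negligible _ _ _ P (Y @^-1` N)).
    by rewrite -[Z in measurable Z]setTI; exact: (measurable_funPT Y).
  by apply: negligibleS h => t /= Nt; apply.
- by move=> z /= /contrapT.
Qed.

Variables (phi1 phi2 : R -> R) (theta d1 : R).
Hypotheses (XYS : sarmanov X Y phi1 phi2 theta).
Hypotheses (phi1_lim : phi1 x @[x --> +oo] --> d1).
Hypotheses (tail_gt0 : forall x, 0 < tail P X x).

Let mphi1 := sarmanov_measurable1 XYS.
Let mphi2 := sarmanov_measurable2 XYS.

Lemma sarmanov_integral_eq (kappa : R -> R) (A : set (R * R)) :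
  measurable_fun setT kappa ->
  {ae Q, forall z, theta * phi1 z.1 * phi2 z.2 = phi1 z.1 * kappa z.2} ->
  measurable A ->
  P [set t | A (X t, Y t)] = (\int[Q]_(z in A) (1 + phi1 z.1 * kappa z.2)%:E)%E.
Proof.
move=> mk h mA; rewrite (sarmanov_joint XYS mA).
have m1 : measurable_fun setT (fun z : R * R => phi1 z.1).
  exact: (measurableT_comp mphi1 measurable_fst).
have m2 (f : R -> R) : measurable_fun setT f -> measurable_fun setT (fun z : R * R => f z.2).
  by move=> mf; exact: (measurableT_comp mf measurable_snd).
apply: ae_eq_integral => //.
- apply/measurable_EFinP/measurable_funTS; apply: measurable_funD => //.
  by apply: measurable_funM; [exact: measurable_funM|exact: m2].
- apply/measurable_EFinP/measurable_funTS; apply: measurable_funD => //.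
  by apply: measurable_funM => //; exact: m2.
- by apply: filterS h => z hz _; rewrite hz.
Qed.

(* Either [phi1] takes both signs on the support of [X], and then nonnegativity of
   the density bounds [theta * phi2] on the support of [Y], or [phi1 (X) = 0]
   almost everywhere, as its mean is 0, and then [kappa = 0] is suitable. *)
Lemma sarmanov_bounded_kernel : exists (kappa : R -> R) (B : R), [/\ measurable_fun setT kappa,
  (forall v, `|kappa v| <= B), (forall v, 0 <= 1 + d1 * kappa v),
  (forall A : set (R * R), measurable A -> P [set t | A (X t, Y t)] =
     (\int[Q]_(z in A) (1 + phi1 z.1 * kappa z.2)%:E)%E) &
  {ae P, forall t, d1 * kappa (Y t) = theta * d1 * phi2 (Y t)}].
Proof.
have [sgn|nsgn] := pselect ((exists2 x, Defs.support X x & 0 < phi1 x) /\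
                            (exists2 x, Defs.support X x & phi1 x < 0)).
- move: sgn => [[xp sxp xp0] [xm sxm xm0]].
  (* Nonnegativity of the density at [xp] gives [theta * phi2 >= - (phi1 xp)^-1], and at [xm] it
     gives [theta * phi2 <= - (phi1 xm)^-1]. *)
  pose B := Num.max (phi1 xp)^-1 (- (phi1 xm)^-1).
  pose good := [set v | `|theta * phi2 v| <= B /\ 0 <= 1 + d1 * (theta * phi2 v)].
  have mt : measurable_fun setT (fun v => theta * phi2 v) by exact: measurable_funM.
  have mgood : measurable good.
    have -> : good = (fun v => `|theta * phi2 v|) @^-1` `]-oo, B] `&`
       (fun v => 1 + d1 * (theta * phi2 v)) @^-1` `[0, +oo[.
      by apply/seteqP; split => v /=; rewrite !in_itv/= andbT.
    apply: measurableI.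
      by rewrite -[X in measurable X]setTI; apply: measurableT_comp.
    rewrite -[X in measurable X]setTI.
    have : measurable_fun setT (fun v => 1 + d1 * (theta * phi2 v)).
      by apply: measurable_funD => //; exact: measurable_funM.
    by apply.
  have goodY y : Defs.support Y y -> good y.
    move=> sy; split.
      have hp := sarmanov_ge0 XYS sxp sy; have hm := sarmanov_ge0 XYS sxm sy.
      rewrite ler_norml; apply/andP; split.
        rewrite lerNl; apply: (@le_trans _ _ (phi1 xp)^-1); last by rewrite le_max lexx.
        by rewrite -[leRHS]mul1r ler_pdivlMr//; lra.
      apply: (@le_trans _ _ (- (phi1 xm)^-1)); last by rewrite le_max lexx orbT.
      by rewrite -invrN -[leRHS]mul1r ler_pdivlMr ?oppr_gt0//; lra.
    (* The support of [X] is unbounded above, so the nonnegativity condition passes to the limit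
       [phi1 x --> d1] along its points. *)
    rewrite leNgt; apply/negP => neg.
    have : (fun x => 1 + phi1 x * (theta * phi2 y)) x @[x --> +oo] -->
        1 + d1 * (theta * phi2 y).
      by apply: cvgD; [exact: cvg_cst|apply: cvgM => //; exact: cvg_cst].
    move=> /cvgr_lt/(_ _ neg)/near_eventually[x0 x00 hx0].
    have [x sx x0x] := tail_support (tail_gt0 x0).
    have := hx0 x (ltW x0x); have := sarmanov_ge0 XYS sx sy; lra.
  pose kappa v := theta * phi2 v * \1_good v.
  have mk : measurable_fun setT kappa by apply: measurable_funM => //; exact: measurable_indic.
  have kgood v : good v -> kappa v = theta * phi2 v.
    by move=> gv; rewrite /kappa indicE mem_set// mulr1.
  have ae_good : {ae P, forall t, good (Y t)}.
    by apply: filterS (ae_support Y) => t; exact: goodY.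
  have B0 : 0 <= B by rewrite le_max invr_ge0 (ltW xp0).
  exists kappa, B; split => //.
  + move=> v; rewrite /kappa; case: (indic_cases R good v) => -[gv ->].
      by rewrite mulr1; case: gv.
    by rewrite mulr0 normr0.
  + move=> v; rewrite /kappa; case: (indic_cases R good v) => -[gv ->].
      by rewrite mulr1; case: gv.
    by rewrite !mulr0 addr0.
  + move=> A mA; apply: sarmanov_integral_eq => //.
    have : {ae Q, forall z, ~ (~` good) z.2}.
      apply: ae_snd; first exact: measurableC.
      by apply: filterS ae_good => t gt /=; apply.
    by apply: filterS => z /= /contrapT gz; rewrite kgood//; ring.
  + by apply: filterS ae_good => t /kgood ->; ring.
- have phi0 : {ae P, forall t, phi1 (X t) = 0}.
    have If := sarmanov_integrable1 XYS.
    have If0 := sarmanov_mean1 XYS.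
    have mc : measurable_fun setT (phi1 \o X) by exact: measurableT_comp.
    (* [s] is the constant sign of [phi1] on the support; [|phi1 (X)| = s * phi1 (X)] then has mean
       0. *)
    have [s sE hs] : exists2 s : R, s ^+ 2 = 1 & {ae P, forall t, 0 <= s * phi1 (X t)}.
      have [hp|hp] := pselect (exists2 x, Defs.support X x & 0 < phi1 x).
        exists 1; first by rewrite expr1n.
        apply: filterS (ae_support X) => t st; rewrite mul1r leNgt; apply/negP => h.
        by apply: nsgn; split => //; exists (X t).
      exists (-1); first by rewrite sqrrN expr1n.
      apply: filterS (ae_support X) => t st; rewrite mulN1r oppr_ge0 leNgt; apply/negP => h.
      by apply: hp; exists (X t).
    have Eabs : (\int[P]_t `|(phi1 (X t))%:E|)%E = 0%E.
      rewrite (ae_eq_integral (fun t => (s * phi1 (X t))%:E))//; last 3 first.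
      + by apply: measurableT_comp => //; exact/measurable_EFinP.
      + by apply/measurable_EFinP; exact: measurable_funM.
      + apply: filterS hs => t st _ /=; congr EFin.
        have /eqP := sE; rewrite sqrf_eq1 => /orP[] /eqP s1; move: st; rewrite s1.
          by rewrite mul1r => /ger0_norm.
        by rewrite mulN1r oppr_ge0 => /ler0_norm.
      under eq_integral do rewrite EFinM.
      rewrite (integralZl _ If)//.
      by move: If0; rewrite unlock => ->; rewrite mule0.
    have mcE : measurable_fun setT (fun t => (phi1 (X t))%:E) by exact/measurable_EFinP.
    have := (ae_eq_integral_abs P measurableT mcE).1 Eabs.
    by apply: filterS => t /(_ I) [].
  (* [X] exceeds every level with positive probability while [phi1 (X) = 0] almost surely, so a
     nonzero limit is impossible. *)
  have d10 : d1 = 0.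
    apply/eqP; rewrite -normr_le0 leNgt; apply/negP => d1p.
    move/cvgrPdist_lt : phi1_lim => /(_ _ d1p) /near_eventually[x0 x00 hx0].
    have : P [set t | x0 < X t] = 0%E.
      apply: measure_negligible; first exact: measurable_ltr_set.
      apply: negligibleS phi0 => t /= xt pt; have := hx0 _ (ltW xt).
      by rewrite pt subr0 ltxx.
    by move=> h; have := tail_gt0 x0; rewrite /tail h ltxx.
  exists (fun=> 0), 0; split => //.
  + by move=> v; rewrite normr0.
  + by move=> v; rewrite mulr0 addr0.
  + move=> A mA; apply: (@sarmanov_integral_eq (fun=> 0)) => //.
    have : {ae Q, forall z, ~ (phi1 @^-1` (~` [set 0])) z.1}.
      apply: ae_fst.
        rewrite -[X in measurable X]setTI; apply: mphi1 => //.
        exact: measurableC.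
      by apply: filterS phi0 => t /= -> ; apply.
    by apply: filterS => z /= /contrapT ->; rewrite mulr0 !mul0r.
  + by apply: nearW => t; rewrite d10 !(mulr0, mul0r).
Qed.

End sarmanov_kernel.

(** * Tail of the product for a bounded second kernel *)

Section bounded_kernel_pair.
Context d (T : measurableType d) (R : realType) (P : probability T R).
Variables (X Y : {RV P >-> R}) (phi1 kappa : R -> R) (d1 B : R).
Local Notation QX := (distribution P X).
Local Notation QY := (distribution P Y).
Local Notation Q := ((QX \x QY)%E).
Hypotheses (Y_ge0 : {ae P, forall t, 0 <= Y t}).
Hypotheses (mphi : measurable_fun setT phi1) (Iphi : intble P (phi1 \o X)).
Hypotheses (phi1_lim : phi1 x @[x --> +oo] --> d1).
Hypotheses (mk : measurable_fun setT kappa) (kB : forall v, `|kappa v| <= B).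
Hypotheses (k_ge0 : forall v, 0 <= 1 + d1 * kappa v).
Hypotheses (joint : forall A : set (R * R), measurable A -> P [set t | A (X t, Y t)] =
     (\int[Q]_(z in A) (1 + phi1 z.1 * kappa z.2)%:E)%E).

Let B0 : 0 <= B. Proof. exact: le_trans (normr_ge0 _) (kB 0). Qed.

Let mX : measurable_fun setT X. Proof. exact: measurable_funPT. Qed.
Let mY : measurable_fun setT Y. Proof. exact: measurable_funPT. Qed.

Lemma intble_distribution (Z : {RV P >-> R}) (f : R -> R) : measurable_fun setT f ->
  intble P (f \o Z) -> intble (distribution P Z) f.
Proof.
move=> mf If; apply: integrable_pushforward => //.
exact/measurable_EFinP.
Qed.

Lemma Rintegral_distribution (Z : {RV P >-> R}) (f : R -> R) : measurable_fun setT f ->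
  intble P (f \o Z) -> \int[distribution P Z]_x f x = \int[P]_t f (Z t).
Proof.
by move=> mf If; congr fine; rewrite integral_distribution//; exact/measurable_EFinP.
Qed.

Lemma Rintegral_prod21 (f : R * R -> R) : intble Q f ->
  \int[Q]_z f z = \int[QY]_y \int[QX]_x f (x, y).
Proof.
move=> If; rewrite /Rintegral -(integral21_prod_meas1 If); congr fine.
apply: ae_eq_integral => //.
- exact: (measurable_fubini_G If).
- apply/measurable_EFinP/measurableT_comp => //.
  exact: (measurable_fubini_G If).
- apply: filterS (ae_integrable2 If) => x /= Ifx _.
  by rewrite /fubini_G fineK//; exact: (integrable_fin_num _ Ifx).
Qed.

(** [Q] is the law of independent copies of [X] and [Y]; their dependence is carried by the density
    alone. *)
Lemma Rintegral_independent (f g : R -> R) :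
  measurable_fun setT f -> measurable_fun setT g ->
  intble P (f \o X) -> intble P (g \o Y) ->
  \int[Q]_z (f z.1 * g z.2) = \int[P]_t f (X t) * \int[P]_t g (Y t).
Proof.
move=> mf mg If Ig.
have If' := intble_distribution mf If; have Ig' := intble_distribution mg Ig.
rewrite Rintegral_prod21; last exact: intble_prod.
rewrite -(Rintegral_distribution mg Ig) -RintegralZl//.
apply: eq_Rintegral => y _; rewrite /= RintegralZr//.
by rewrite (Rintegral_distribution mf If).
Qed.

Let Ikappa : intble QY kappa.
Proof. exact: (intble_bounded QY mk kB). Qed.

Let Iphi' : intble QX phi1.
Proof. exact: intble_distribution. Qed.

Let Idens : intble Q (fun z => 1 + phi1 z.1 * kappa z.2).
Proof.
apply: intbleD; last exact: intble_prod.
have I1 (Z : {RV P >-> R}) : intble (distribution P Z) (fun=> 1).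
  exact: finite_measure_integrable_cst.
by apply: eq_integrable (intble_prod (I1 X) (I1 Y)) => // z _ /=; rewrite mulr1.
Qed.

Lemma joint_Rintegral (A : set (R * R)) : measurable A ->
  fine (P [set t | A (X t, Y t)]) = \int[Q]_z ((1 + phi1 z.1 * kappa z.2) * \1_A z).
Proof.
move=> mA; rewrite joint//.
rewrite -[LHS]/(\int[Q]_(z in A) (1 + phi1 z.1 * kappa z.2)) Rintegral_mkcond.
apply: eq_Rintegral => z _; rewrite patchE indicE.
by case: ifP; rewrite ?mulr1 ?mulr0.
Qed.

Let F := tail P X.
Let U := tail P (X \* Y)%R.
Let w t := 1 + d1 * kappa (Y t).

Lemma tail_noninc (Z : T -> R) : measurable_fun setT Z ->
  {homo tail P Z : x y / x <= y >-> y <= x}.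
Proof.
move=> mZ x y xy; rewrite /tail fine_le ?fin_num_measure//; try exact: measurable_ltr_set.
apply: le_measure; rewrite ?inE; try exact: measurable_ltr_set.
by move=> t /=; exact: le_lt_trans.
Qed.

Lemma tail_ge0 (Z : T -> R) x : 0 <= tail P Z x.
Proof. by rewrite /tail fine_ge0. Qed.

Lemma tail_le1 (Z : T -> R) x : measurable_fun setT Z -> tail P Z x <= 1.
Proof.
move=> mZ; rewrite /tail -[leRHS]/(fine 1%E) fine_le ?fin_num_measure//.
  exact: measurable_ltr_set.
by apply: probability_le1; exact: measurable_ltr_set.
Qed.

Let mrect (a c : R) : measurable [set z : R * R | a < z.1 /\ c < z.2].
Proof.
apply: measurableI.
  by apply: (@measurable_ltr_set _ _ R (fun z : R * R => z.1)); exact: measurable_fst.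
by apply: (@measurable_ltr_set _ _ R (fun z : R * R => z.2)); exact: measurable_snd.
Qed.

Let mw : measurable_fun setT w.
Proof.
apply: measurable_funD => //; apply: measurable_funM => //.
exact: measurableT_comp.
Qed.

Let wB t : `|w t| <= 1 + `|d1| * B.
Proof.
apply: le_trans (ler_normD _ _) _; rewrite normr1 lerD2l normrM.
by rewrite ler_wpM2l.
Qed.

(* [X > x / c] and [Y > c] imply [X * Y > x]. On this rectangle [phi1] is close to
   [d1] even when [Y] is large. *)
Lemma tail_product_lower (c : R) : 0 < c -> 0 < \int[P]_t (w t * \1_[set t | c < Y t] t) ->
  exists2 C, 0 < C & eventually_ge (fun x => F (x / c) <= C * U x).
Proof.
(* [eta] is chosen so that [eta * B <= m / 2]: replacing [phi1] by [d1] costs at most half of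
   [m]. *)
move=> c0; set m := \int[P]_t _ => m0.
pose eta := m / (2 * (B + 1)).
have B1 : 0 < B + 1 by rewrite ltr_wpDl.
have eta0 : 0 < eta by rewrite divr_gt0// mulr_gt0.
have etaB : eta * B <= m / 2.
  rewrite /eta invfM mulrA -mulrA ler_piMr ?divr_ge0 ?(ltW m0)//.
  by rewrite mulrC ler_pdivrMr// mul1r lerDl.
have [x1 x10 hx1] := (eventually_cvg _ _).1 phi1_lim _ eta0.
exists (2 / m); first by rewrite divr_gt0.
exists (x1 * c); first by rewrite mulr_gt0.
move=> x x1x.
have {}x1x : x1 <= x / c by rewrite ler_pdivlMr.
have xc0 : 0 < x / c by exact: lt_le_trans x1x.
have hx u : x / c <= u -> `|phi1 u - d1| <= eta.
  by move=> xu; apply: hx1; exact: le_trans xu.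
pose A := [set z : R * R | x / c < z.1 /\ c < z.2].
have mA' : measurable [set t | x / c < X t /\ c < Y t].
  by apply: measurableI; exact: measurable_ltr_set.
have mXY : measurable [set t | x < (X \* Y)%R t].
  by apply: measurable_ltr_set; exact: measurable_funM.
have h1 : fine (P [set t | A (X t, Y t)]) <= U x.
  rewrite /U /tail; apply: fine_le; [exact: fin_num_measure|exact: fin_num_measure|].
  apply: le_measure; [by rewrite inE|by rewrite inE|].
  move=> t [/= xX cY]; have -> : x = x / c * c by rewrite mulfVK// gt_eqF.
  by rewrite ltr_pM// ltW.
pose f u : R := \1_[set u | x / c < u] u.
(* On the rectangle the density is at least [1 + d1 * kappa - eta * B], which no longer involves
   [x], so the integral factors. *)
pose g v := (1 + d1 * kappa v - eta * B) * \1_[set v | c < v] v.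
have mi (a : R) : measurable [set u : R | a < u] by apply: measurable_ltr_set.
have mf : measurable_fun setT f by exact: measurable_indic.
have mg : measurable_fun setT g.
  apply: measurable_funM; last exact: measurable_indic.
  apply: measurable_funB => //; apply: measurable_funD => //.
  exact: measurable_funM.
have If : intble P (f \o X).
  apply: (@intble_bounded _ _ _ _ 1); first exact: measurableT_comp.
  by move=> t; exact: normr_indic_le1.
have mc : measurable [set t | c < Y t] by exact: measurable_ltr_set.
have Iw : intble P w by exact: intble_bounded wB.
have gE t : g (Y t) = w t * \1_[set t | c < Y t] t - eta * B * \1_[set t | c < Y t] t.
  rewrite /g /w mulrBl; case: (indic_cases R [set v | c < v] (Y t)) => -[/= hv ->];
  by case: (indic_cases R [set t | c < Y t] t) => -[/= hv' ->].
have I1 : intble P (fun t => w t * \1_[set t | c < Y t] t) by exact: intble_indic.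
have I2 : intble P (fun t => eta * B * \1_[set t | c < Y t] t).
  by apply: intble_indic => //; exact: finite_measure_integrable_cst.
have Ig : intble P (g \o Y).
  by apply: eq_integrable (intbleB I1 I2) => // t _ /=; rewrite gE.
have h2 : \int[Q]_z (f z.1 * g z.2) <= fine (P [set t | A (X t, Y t)]).
  rewrite joint_Rintegral; last exact: mrect.
  apply: Rintegral_le.
  - by apply: intble_prod; exact: intble_distribution.
  - by apply: intble_indic => //; exact: mrect.
  - move=> z; rewrite /f /g.
    case: (indic_cases R [set u | x / c < u] z.1) => -[/= hu ->]; last first.
      by rewrite mul0r indicE memNset ?mulr0// => -[].
    case: (indic_cases R [set v | c < v] z.2) => -[/= hv ->]; last first.
      by rewrite !mulr0 indicE memNset ?mulr0// => -[].
    rewrite indicE mem_set//= !mulr1 mul1r -addrA lerD2l lerBlDr.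
    rewrite -lerBlDl -mulrBl (le_trans (ler_norm _))// normrM ler_pM//.
    by rewrite distrC; apply: hx; exact: ltW.
apply: (@le_trans _ _ (2 / m * \int[Q]_z (f z.1 * g z.2))); last first.
  by rewrite ler_wpM2l ?divr_ge0 ?(ltW m0)// (le_trans h2).
rewrite (Rintegral_independent mf mg If Ig).
have -> : \int[P]_t f (X t) = F (x / c).
  by rewrite /F tail_Rintegral.
have hg : m / 2 <= \int[P]_t g (Y t).
  rewrite (eq_Rintegral _ (fun t _ => gE t)) RintegralB// -/m.
  have Ic : intble P (\1_[set t | c < Y t] : T -> R).
    apply: (@intble_bounded _ _ _ _ 1); first exact: measurable_indic.
    by move=> t; exact: normr_indic_le1.
  rewrite RintegralZl// -tail_Rintegral// lerBrDr.
  have := tail_le1 c mY; have := tail_ge0 Y c.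
  move: (tail P Y c) => q q0 q1.
  have : eta * B * q <= m / 2.
    by apply: le_trans etaB; rewrite ler_piMr// mulr_ge0// ltW.
  by move=> h; rewrite [leRHS](splitr m) lerD2l.
rewrite mulrCA ler_peMr ?tail_ge0//.
apply: (@le_trans _ _ (2 / m * (m / 2))).
  by rewrite le_eqVlt; apply/orP; left; apply/eqP; field; rewrite gt_eqF.
by rewrite ler_wpM2l// divr_ge0// ltW.
Qed.

Section product_tail_regular.
Variables (al : R).
Hypotheses (al0 : 0 < al) (RVU : regularly_varying al U).
Hypotheses (F_gt0 : forall x, 0 < F x).
Let W := mellin_weight Y al w.
Hypotheses (IW : intble P W) (W_gt0 : 0 < \int[P]_t W t).

Let w_ge0 t : 0 <= w t. Proof. exact: k_ge0. Qed.

Let W_ge0 t : 0 <= W t.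
Proof. by rewrite /W /mellin_weight !mulr_ge0// powR_ge0. Qed.

Let U_noninc : {homo U : x y / x <= y >-> y <= x}.
Proof. by apply: tail_noninc; exact: measurable_funM. Qed.

(* Truncating [Y] both near 0 and near infinity leaves a part of [W] of positive
   mass, bounded by a multiple of [w]. *)
Lemma weight_away0 : exists2 c, 0 < c & 0 < \int[P]_t (w t * \1_[set t | c < Y t] t).
Proof.
pose E := \int[P]_t W t; have E0 : 0 < E := W_gt0.
have e4 : 0 < E / 4 by rewrite divr_gt0.
have mln : measurable_fun setT (fun t => - ln (Y t)).
  apply: (measurableT_comp (@oppr_measurable R setT)).
  exact: (measurableT_comp (@measurable_ln R) mY).
have [L L0 hL] := Rintegral_tail IW W_ge0 mln e4.
have [M M0 hM] := Rintegral_tail IW W_ge0 mY e4.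
have {hL} := hL L (lexx _); have {hM} := hM M (lexx _) => hM hL.
(* Halving makes [c < Y t] strict when [Y t >= expR (- L)]. *)
pose c := expR (- L) / 2.
have c0 : 0 < c by rewrite divr_gt0 ?expR_gt0.
exists c => //.
have mc : measurable [set t | c < Y t] by exact: measurable_ltr_set.
have mMs : measurable [set t | M < Y t] by exact: measurable_ltr_set.
have mLs : measurable [set t | L < - ln (Y t)] by exact: measurable_ltr_set.
have Iw : intble P w by exact: intble_bounded wB.
have I1 := intble_indic mLs IW; have I2 := intble_indic mMs IW.
have I3 := intbleZl (M `^ al + 1) (intble_indic mc Iw).
have I12 := intbleD I1 I2.
have : E <= \int[P]_t (W t * \1_[set t | L < - ln (Y t)] t + W t * \1_[set t | M < Y t] t
    + (M `^ al + 1) * (w t * \1_[set t | c < Y t] t)).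
  apply: Rintegral_le => //; first exact: intbleD.
  move=> t; have Mp : 0 <= M `^ al + 1 by rewrite addr_ge0// powR_ge0.
  have nn (A : set T) : 0 <= W t * \1_A t by rewrite mulr_ge0.
  have nn' (A : set T) : 0 <= (M `^ al + 1) * (w t * \1_A t) by rewrite !mulr_ge0.
  have [Y0|Y0] := lerP (Y t) 0.
    rewrite {1}/W /mellin_weight.
    case: (indic_cases R [set t | 0 < Y t] t) => -[/= Y0' ->].
      by have := lt_le_trans Y0' Y0; rewrite ltxx.
    by rewrite !mulr0 !addr_ge0.
  case: (indic_cases R [set t | L < - ln (Y t)] t) => -[/= h1 ->].
    by rewrite mulr1 -addrA lerDl addr_ge0.
  case: (indic_cases R [set t | M < Y t] t) => -[/= h2 ->].
    by rewrite mulr0 add0r mulr1 lerDl.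
  rewrite !mulr0 !add0r.
  move/negP : h1; rewrite -leNgt lerNl => h1; move/negP : h2; rewrite -leNgt => h2.
  have eY : expR (- L) <= Y t by rewrite -[leRHS]lnK// ler_expR.
  have cY : c < Y t.
    by apply: lt_le_trans eY; rewrite /c ltr_pdivrMr// ltr_pMr ?expR_gt0// ltr1n.
  rewrite indicE mem_set//= mulr1 /W /mellin_weight indicE mem_set//= mulr1 mulrC.
  rewrite ler_wpM2r//.
  apply: (@le_trans _ _ (M `^ al)); last by rewrite lerDl.
  by apply: ge0_ler_powR; rewrite ?nnegrE ?(ltW Y0) ?(ltW M0) ?(ltW al0).
rewrite RintegralD// RintegralD// RintegralZl//; last exact: intble_indic.
move: hL hM; set a := \int[P]_t _; set b := \int[P]_t _; set m := \int[P]_t _ => hL hM h.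
have : 0 < (M `^ al + 1) * m by lra.
by rewrite pmulr_rgt0// ltr_wpDl// powR_ge0.
Qed.

(** [tail_product_lower] gives [U > 0] far out, hence everywhere by monotonicity. Only then can
    regular variation of [U] remove the scale [c]: [F x <= C * U (x * c) <= C * D * U x]. *)
Lemma tail_product_dominates : (forall x, 0 < U x) /\
  exists2 C, 0 < C & eventually_ge (fun x => F x <= C * U x).
Proof.
have [c c0 mc] := weight_away0.
have [C C0 hC] := tail_product_lower c0 mc.
have U0 x : 0 < U x.
  have [x0 x00 h0] := hC.
  apply: (@lt_le_trans _ _ (U (Num.max x x0))); last by apply: U_noninc; rewrite le_max lexx.
  have := h0 (Num.max x x0); rewrite le_max lexx orbT => /(_ isT) h.
  by rewrite -(pmulr_rgt0 _ C0) (lt_le_trans _ h).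
split => //; pose D := c `^ (- al) + 1.
have D0 : 0 < D by rewrite ltr_wpDl// powR_ge0.
exists (C * D); first by rewrite mulr_gt0.
have h1 : eventually_ge (fun x => U (x * c) <= D * U x).
  by apply: (RV_le U0 RVU) => //; rewrite /D ltrDl.
apply: eventually_mono (eventually_and (eventually_mulr c0 hC) h1) => x x0 [k1 k2].
move: k1; rewrite mulfK ?gt_eqF// => /le_trans; apply.
by rewrite -mulrA ler_wpM2l// ltW.
Qed.

Let A x := [set z : R * R | 0 < z.2 /\ x < z.1 * z.2].

Let mA x : measurable (A x).
Proof.
apply: measurableI.
  by apply: (@measurable_ltr_set _ _ R (fun z : R * R => z.2)); exact: measurable_snd.
apply: (@measurable_ltr_set _ _ R (fun z : R * R => z.1 * z.2)).
by apply: measurable_funM; [exact: measurable_fst|exact: measurable_snd].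
Qed.

Let H := mellin_kernel Y F.

Let F_noninc : {homo F : x y / x <= y >-> y <= x}.
Proof. exact: tail_noninc. Qed.

Let F_le1 x : F x <= 1. Proof. exact: tail_le1. Qed.

(** For fixed [y > 0], the section of [A x] is the half-line above [x / y], whose [QX]-measure is
    [F (x / y)]. *)
Lemma Rintegral_hyperbolic (k : R -> R) (K x : R) : measurable_fun setT k ->
  (forall v, `|k v| <= K) ->
  \int[Q]_z (k z.2 * \1_(A x) z) = \int[P]_t (k (Y t) * H x t).
Proof.
move=> mk' kK.
have Ione : intble QX (fun=> 1) by exact: finite_measure_integrable_cst.
have Ik : intble QY k by exact: (intble_bounded QY mk' kK).
have I0 : intble Q (fun z => k z.2).
  by apply: eq_integrable (intble_prod Ione Ik) => // z _ /=; rewrite mul1r.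
rewrite Rintegral_prod21; last exact: intble_indic.
pose Hid : R -> R := @mellin_kernel _ (measurableTypeR R) R id F x.
have mHid : measurable_fun setT Hid.
  exact: (@measurable_mellin_kernel _ (measurableTypeR R) R id F
    (@measurable_id _ _ _) F_noninc x).
have mkH : measurable_fun setT (fun y => k y * Hid y) by exact: measurable_funM.
transitivity (\int[QY]_y (k y * Hid y)); last first.
  rewrite Rintegral_distribution//.
  apply: (@intble_bounded _ _ _ _ K); first exact: measurableT_comp.
  move=> t /=; rewrite normrM -[leRHS]mulr1 ler_pM//.
  rewrite ger0_norm; first exact: (mellin_kernel_le1 _ F_le1).
  exact: (mellin_kernel_ge0 _ F_gt0).
apply: eq_Rintegral => y _ /=.
have mi (a : R) : measurable [set u : R | a < u] by apply: measurable_ltr_set.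
have [y0|y0] := lerP y 0.
  rewrite Rintegral_eq0; last first.
    by move=> u; rewrite indicE memNset ?mulr0// => -[/= /lt_le_trans/(_ y0)]; rewrite ltxx.
  rewrite /Hid /mellin_kernel indicE memNset ?mul0r ?mulr0//= => y0'.
  by have := lt_le_trans y0' y0; rewrite ltxx.
have I1 : intble QX (\1_[set u : R | x / y < u] : R -> R).
  apply: (@intble_bounded _ _ _ _ 1); first exact: measurable_indic.
  by move=> u; exact: normr_indic_le1.
transitivity (\int[QX]_u (k y * \1_[set u : R | x / y < u] u)).
  apply: eq_Rintegral => u _; congr (_ * _).
  case: (indic_cases R [set u : R | x / y < u] u) => -[/= h ->].
    by rewrite indicE mem_set// /A/=; split => //; rewrite -ltr_pdivrMr.
  rewrite indicE memNset// => -[/= _ h']; apply: h.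
  by rewrite ltr_pdivrMr.
rewrite RintegralZl//; congr (_ * _).
rewrite /Hid /mellin_kernel indicE mem_set//= mul1r Rintegral_distribution.
- by rewrite /F tail_Rintegral.
- exact: measurable_indic.
- apply: (@intble_bounded _ _ _ _ 1).
    by apply: measurableT_comp => //; exact: measurable_indic.
  by move=> t; exact: normr_indic_le1.
Qed.

Lemma tail_productE (x : R) : 0 < x ->
  U x = \int[Q]_z ((1 + phi1 z.1 * kappa z.2) * \1_(A x) z).
Proof.
move=> x0; rewrite -joint_Rintegral//.
have m1 : measurable [set t | x < (X \* Y)%R t].
  by apply: measurable_ltr_set; exact: measurable_funM.
have m2 : measurable [set t | A x (X t, Y t)].
  apply: measurableI; first exact: measurable_ltr_set.
  by apply: (@measurable_ltr_set _ _ _ (fun t => X t * Y t)); exact: measurable_funM.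
have fineE (D : set T) : measurable D -> fine (P D) = \int[P]_t \1_D t.
  by move=> mD; rewrite /Rintegral integral_indic// setIT.
rewrite /U /tail !fineE//; apply: Rintegral_ae_eq; try exact: measurable_indic.
apply: filterS Y_ge0 => t Yt.
case: (indic_cases R [set t | A x (X t, Y t)] t) => -[/= h ->].
  by rewrite indicE mem_set//=; case: h.
rewrite indicE memNset//= => h'; apply: h; split => //=.
rewrite lt_neqAle Yt andbT; apply/eqP => Y0; move: h'; rewrite -Y0 mulr0 => /lt_trans/(_ x0).
by rewrite ltxx.
Qed.

(** The error is at most the integral of [B * |phi1 - d1|] over [A x]. Where [z.1 >= M] this is at
    most [B * eta] times the measure of [A x], which is [O(U x)]. Where [z.1 < M], membership in
    [A x] forces [z.2 > x / M], and under [Q] this part is at most [B * D * P[Y > x / M]]. *)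
Lemma tail_product_mellin (e C : R) : 0 < e -> 0 <= C ->
  (forall a e, 0 < a -> 0 < e -> eventually_ge (fun x => tail P Y (x / a) <= e * U x)) ->
  eventually_ge (fun x => \int[P]_t H x t <= C * U x) ->
  eventually_ge (fun x => `|\int[P]_t (w t * H x t) - U x| <= e * U x).
Proof.
move=> e0 C0 htail hH.
pose D := \int[P]_t `|phi1 (X t) - d1|.
have mD : measurable_fun setT (fun u => `|phi1 u - d1|).
  by apply: measurableT_comp => //; exact: measurable_funB.
have ID : intble P ((fun u => `|phi1 u - d1|) \o X).
  by apply: intble_norm; apply: intbleB => //; exact: finite_measure_integrable_cst.
have D0 : 0 <= D by exact: Rintegral_ge0.
pose eta := e / (2 * (B * C + 1)).
have BC1 : 0 < 2 * (B * C + 1) by rewrite mulr_gt0// ltr_wpDl// mulr_ge0.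
have BD1 : 0 < 2 * (B * D + 1) by rewrite mulr_gt0// ltr_wpDl// mulr_ge0.
have eta0 : 0 < eta by rewrite divr_gt0.
have [M M0 hM] := (eventually_cvg _ _).1 phi1_lim _ eta0.
have h1 := htail M (e / (2 * (B * D + 1))) M0 (divr_gt0 e0 BD1).
apply: eventually_mono (eventually_and hH h1) => x x0 [k1 k2].
have mv : measurable_fun setT (fun v => 1 + d1 * kappa v).
  by apply: measurable_funD => //; exact: measurable_funM.
have hv v : `|1 + d1 * kappa v| <= 1 + `|d1| * B.
  by apply: le_trans (ler_normD _ _) _; rewrite normr1 lerD2l normrM ler_wpM2l.
rewrite -(@Rintegral_hyperbolic (fun v => 1 + d1 * kappa v) _ x mv hv) {1}(tail_productE x0).
have Ione : intble QX (fun=> 1) by exact: finite_measure_integrable_cst.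
have IoneY : intble QY (fun=> 1) by exact: finite_measure_integrable_cst.
have Iv : intble Q (fun z => 1 + d1 * kappa z.2).
  have Iv' := intble_bounded QY mv hv.
  by apply: eq_integrable (intble_prod Ione Iv') => // z _ /=; rewrite mul1r.
rewrite -RintegralB//; try exact: intble_indic.
have mt : measurable [set v : R | x / M < v] by apply: measurable_ltr_set.
pose g v : R := \1_[set v | x / M < v] v.
have mg : measurable_fun setT g by exact: measurable_indic.
have g0 v : 0 <= g v by rewrite /g; case: (indic_cases R [set v | x / M < v] v) => -[_ ->].
have gle v : `|g v| <= 1 by exact: normr_indic_le1.
have Ig : intble P (g \o Y).
  by apply: (@intble_bounded _ _ _ _ 1) => [|t]; [exact: (measurableT_comp mg mY)|exact: gle].
have Ig' : intble QY g by exact: (intble_bounded QY mg gle).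
have ID' := intble_distribution mD ID.
have J1 : intble Q (\1_(A x) : R * R -> R).
  have := intble_indic (mA x) (intble_prod Ione IoneY).
  by apply: eq_integrable => // z _ /=; rewrite !mul1r.
have J2 := intble_prod ID' Ig'.
have J := intbleD (intbleZl (B * eta) J1) (intbleZl B J2).
apply: le_trans (Rintegral_norm_le _ J _) _.
- by apply: intbleB; exact: intble_indic.
- move=> z; case: (indic_cases R (A x) z) => -[/= hz ->]; last first.
    rewrite !mulr0 subrr normr0 add0r.
    by apply: mulr_ge0 => //; exact: mulr_ge0.
  rewrite !mulr1 opprD addrACA subrr add0r -mulrBl normrM distrC mulrC.
  rewrite -mulrDr; apply: ler_pM => //.
  have [zM|zM] := lerP M z.1.
    by rewrite ler_wpDr ?hM//; exact: mulr_ge0.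
  case: hz => z2 xz; rewrite /g indicE mem_set; last first.
    rewrite /= ltr_pdivrMr// (lt_trans xz)// mulrC ltr_pM2l//.
  by rewrite mulr1 ler_wpDl// ltW.
rewrite RintegralD//; try exact: intbleZl.
rewrite !RintegralZl// (Rintegral_independent mD mg ID Ig) -/D.
have -> : \int[P]_t g (Y t) = tail P Y (x / M) by rewrite tail_Rintegral.
have -> : \int[Q]_z \1_(A x) z = \int[P]_t H x t.
  have := @Rintegral_hyperbolic (fun=> 1) 1 x (measurable_cst _).
  under eq_Rintegral do rewrite mul1r.
  move=> -> //; last by move=> _; rewrite normr1.
  by apply: eq_Rintegral => t _; rewrite mul1r.
rewrite [in leRHS](splitr e) mulrDl lerD//.
  apply: (@le_trans _ _ (B * eta * (C * U x))).
    by rewrite ler_wpM2l// mulr_ge0// ltW.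
  rewrite mulrA ler_wpM2r ?tail_ge0// /eta.
  rewrite (_ : B * (e / _) * C = (B * C * e) / (2 * (B * C + 1))); last first.
    by rewrite mulrA mulrAC [B * e * C]mulrAC.
  rewrite ler_pdivrMr// (_ : e / 2 * _ = B * C * e + e); last by field.
  by rewrite lerDl ltW.
rewrite mulrA; apply: (@le_trans _ _ (B * D * (e / (2 * (B * D + 1)) * U x))).
  by rewrite ler_wpM2l// mulr_ge0.
rewrite mulrA ler_wpM2r ?tail_ge0// mulrA ler_pdivrMr//.
rewrite (_ : e / 2 * _ = B * D * e + e); last by field.
by rewrite lerDl ltW.
Qed.

End product_tail_regular.

End bounded_kernel_pair.

(** * Transfer to Sarmanov pairs *)

Lemma cvg_mulr_pinfty (R : realType) (f : R -> R) (l a : R) : 0 < a ->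
  f x @[x --> +oo] --> l -> f (x * a) @[x --> +oo] --> l.
Proof.
move=> a0 /eventually_cvg h; apply/eventually_cvg => e /h.
exact: eventually_mulr.
Qed.

Lemma intble_powR_le d (T : measurableType d) (R : realType) (P : probability T R)
    (Y : T -> R) (al eps : R) : measurable_fun setT Y -> 0 < al -> 0 < eps ->
  intble P (fun t => Y t `^ (al + eps)) -> intble P (fun t => Y t `^ al).
Proof.
move=> mY al0 eps0 IZ.
have ale : 0 < al + eps by rewrite addr_gt0.
apply: (@intble_le _ _ _ _ _ (fun t => 1 + Y t `^ (al + eps))).
- exact: (measurableT_comp (@measurable_powR R al) mY).
- move=> t; rewrite ger0_norm ?powR_ge0//.
  have [Y1|Y1] := lerP 1 (Y t).
    by rewrite ler_wpDl// ler_powR// lerDl ltW.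
  rewrite ler_wpDr ?powR_ge0//.
  have [Y0|Y0] := lerP 0 (Y t); last by rewrite lt0_powR1.
  have p1 : (1 : R) `^ al = 1 by rewrite powR1.
  by rewrite -[leRHS]p1 ge0_ler_powR ?nnegrE ?(ltW al0) ?(ltW Y1).
- by apply: intbleD => //; exact: finite_measure_integrable_cst.
Qed.
Theorem theorem2p1 (R : realType) (d : measure_display) (T : measurableType d)
    (P : probability T R) (X Y : {RV P >-> R})
    (phi1 phi2 : R -> R) (theta d1 alpha : R)
    (Y_ge0 : {ae P, forall t, 0 <= Y t})
    (XY_sarmanov : sarmanov X Y phi1 phi2 theta)
    (phi1_lim : phi1 x @[x --> +oo] --> d1)
    (F_D : dominatedly_varying (tail P X))
    (G_o_F : tail P Y x / tail P X x @[x --> +oo] --> (0 : R))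
    (alpha_gt0 : 0 < alpha)
    (XY_RV : regularly_varying alpha (tail P (X \* Y)%R))
    (Y_moment : exists2 eps : R, 0 < eps &
       ('E_P[fun t => (Y t `^ (alpha + eps))%R] < +oo)%E)
    (nonvanishing : forall beta : R,
       cexpect P (fun t => cpowR (Y t) (alpha +i* beta))
       + (theta * d1)%:C
         * cexpect P (fun t => (phi2 (Y t))%:C * cpowR (Y t) (alpha +i* beta))
       <> 0) :
  regularly_varying alpha (tail P X) /\
  asymp_equiv (tail P (X \* Y)%R)
    (fun x => (expect P (fun t => Y t `^ alpha)
               + theta * d1 * expect P (fun t => phi2 (Y t) * Y t `^ alpha))
              * tail P X x).
Proof.
have [eps eps0 EYfin] := Y_moment.
have mX : measurable_fun setT X by exact: measurable_funPT.
have mY : measurable_fun setT Y by exact: measurable_funPT.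
have IZ : intble P (fun t => Y t `^ (alpha + eps)).
  apply/integrableP; split.
    apply/measurable_EFinP; exact: (measurableT_comp (@measurable_powR R _) mY).
  move: EYfin; rewrite unlock; apply: le_lt_trans.
  rewrite le_eqVlt; apply/orP; left; apply/eqP; apply: eq_integral => t _ /=.
  by rewrite ger0_norm// powR_ge0.
have [F_gt0 _] := F_D.
have [kappa [B [mk kB kge0 joint kE]]] := sarmanov_bounded_kernel XY_sarmanov phi1_lim F_gt0.
pose w t := 1 + d1 * kappa (Y t).
pose W := mellin_weight Y alpha w.
have mphi1 := sarmanov_measurable1 XY_sarmanov.
have mphi2 := sarmanov_measurable2 XY_sarmanov.
have Iphi := sarmanov_integrable1 XY_sarmanov.
have mw : measurable_fun setT w.
  apply: measurable_funD => //; apply: measurable_funM => //.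
  exact: measurableT_comp.
have w0 t : 0 <= w t by exact: kge0.
have B0 : 0 <= B by exact: le_trans (normr_ge0 _) (kB 0).
have wB' t : `|w t| <= 1 + `|d1| * B.
  apply: le_trans (ler_normD _ _) _; rewrite normr1 lerD2l normrM.
  by rewrite ler_wpM2l.
have wB t : w t <= 1 + `|d1| * B by exact: le_trans (ler_norm _) (wB' t).
have IYal := intble_powR_le mY alpha_gt0 eps0 IZ.
(* Returns from [kappa] to [phi2] inside expectations. If [theta * d1 = 0], both extra terms are 0
   even when the expectation with [phi2] takes its default value; otherwise [phi2 (Y)] is almost
   surely [d1 * kappa (Y) / (theta * d1)]. *)
have comb (f : T -> R) : measurable_fun setT f -> (forall t, `|f t| <= Y t `^ alpha) ->
    expect P f + theta * d1 * expect P (fun t => phi2 (Y t) * f t) =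
    \int[P]_t (w t * f t).
  move=> mf fY; rewrite /expect unlock -/(Rintegral P setT f).
  rewrite -/(Rintegral P setT (fun t => phi2 (Y t) * f t)).
  have If := intble_le mf fY IYal.
  have Ikf : intble P (fun t => d1 * kappa (Y t) * f t).
    have mkY : measurable_fun setT (fun t => d1 * kappa (Y t)).
      by apply: measurable_funM => //; exact: measurableT_comp.
    have := @intbleMr _ _ _ P (`|d1| * B) f _ mkY => /(_ _ If)/eq_integrable; apply => //.
      by move=> t _ /=; rewrite mulrC.
    by move=> t; rewrite normrM ler_wpM2l.
  rewrite (_ : \int[P]_t (w t * f t) =
    \int[P]_t f t + \int[P]_t (d1 * kappa (Y t) * f t)); last first.
    by rewrite -RintegralD//; apply: eq_Rintegral => t _; rewrite /w mulrDl mul1r.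
  congr (_ + _); have mpf : measurable_fun setT (fun t => phi2 (Y t) * f t).
    by apply: measurable_funM => //; exact: measurableT_comp.
  have [td0|td0] := eqVneq (theta * d1) 0.
    rewrite td0 mul0r -(@Rintegral_eq0 _ _ _ P (fun=> 0))//.
    apply: Rintegral_ae_eq => //; first exact: intble_measurable Ikf.
    by apply: filterS kE => t ->; rewrite td0 !mul0r.
  rewrite (_ : \int[P]_t (phi2 (Y t) * f t) =
    \int[P]_t ((theta * d1)^-1 * (d1 * kappa (Y t) * f t))).
    by rewrite RintegralZl// mulVKf.
  apply: Rintegral_ae_eq => //.
    by apply: measurable_funM => //; exact: intble_measurable Ikf.
  by apply: filterS kE => t ->; rewrite -[theta * d1 * _ * _]mulrA mulKf.
have combW (h : R -> R) : measurable_fun setT h -> (forall x, `|h x| <= 1) ->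
    \int[P]_t (w t * (Y t `^ alpha * h (ln (Y t)))) = \int[P]_t (W t * h (ln (Y t))).
  move=> mh h1; have mhl : measurable_fun setT (fun t => h (ln (Y t))).
    apply: (measurableT_comp mh); exact: (measurableT_comp (@measurable_ln R) mY).
  have mp : measurable_fun setT (fun t => Y t `^ alpha).
    exact: (measurableT_comp (@measurable_powR R _) mY).
  have mi : measurable [set t | 0 < Y t] by exact: measurable_ltr_set.
  apply: Rintegral_ae_eq.
  - by apply: measurable_funM => //; exact: measurable_funM.
  - apply: measurable_funM => //; apply: measurable_funM => //; apply: measurable_funM => //.
  - apply: filterS Y_ge0 => t; rewrite le_eqVlt => /predU1P[Y0|Y0].
      by rewrite /W /mellin_weight -Y0 powR0 ?gt_eqF// !mul0r mulr0 mul0r.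
    by rewrite /W /mellin_weight indicE mem_set//= mulr1 mulrA.
have mcosb b : measurable_fun setT (fun x : R => cos (b * x)).
  apply: (measurableT_comp (continuous_measurable_fun (@continuous_cos R))).
  exact: measurable_funM.
have msinb b : measurable_fun setT (fun x : R => sin (b * x)).
  apply: (measurableT_comp (continuous_measurable_fun (@continuous_sin R))).
  exact: measurable_funM.
have key (h : R -> R) : measurable_fun setT h -> (forall x, `|h x| <= 1) ->
    expect P (fun t => Y t `^ alpha * h (ln (Y t))) +
    theta * d1 * expect P (fun t => phi2 (Y t) * (Y t `^ alpha * h (ln (Y t)))) =
    \int[P]_t (W t * h (ln (Y t))).
  move=> mh h1; rewrite -combW//; apply: comb.
    apply: measurable_funM; first exact: (measurableT_comp (@measurable_powR R _) mY).
    apply: (measurableT_comp mh); exact: (measurableT_comp (@measurable_ln R) mY).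
  by move=> t; rewrite normrM (ger0_norm (powR_ge0 _ _)) ler_piMr ?powR_ge0.
(* By [key] with [cos] and [sin], [fcos] and [fsin] are the real and imaginary parts of the complex
   expression in the hypothesis. *)
have nz b : fcos P (fun t => ln (Y t)) W b ^+ 2 + fsin P (fun t => ln (Y t)) W b ^+ 2 != 0.
  apply/negP; rewrite paddr_eq0 ?sqr_ge0// !sqrf_eq0 => /andP[/eqP c0 /eqP s0].
  apply: (nonvanishing b); rewrite /cexpect.
  have hc := key (fun x => cos (b * x)) (mcosb b) (fun x => normr_cos _).
  have hs := key (fun x => sin (b * x)) (msinb b) (fun x => normr_sin _).
  rewrite -/(fcos P (fun t => ln (Y t)) W b) c0 in hc.
  rewrite -/(fsin P (fun t => ln (Y t)) W b) s0 in hs.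
  have e1 : (fun t => complex.Re ((phi2 (Y t))%:C * cpowR (Y t) (alpha +i* b))) =
            (fun t => phi2 (Y t) * (Y t `^ alpha * cos (b * ln (Y t)))).
    by apply/funext => t /=; rewrite mul0r subr0.
  have e2 : (fun t => complex.Im ((phi2 (Y t))%:C * cpowR (Y t) (alpha +i* b))) =
            (fun t => phi2 (Y t) * (Y t `^ alpha * sin (b * ln (Y t)))).
    by apply/funext => t /=; rewrite mul0r addr0.
  rewrite e1 e2 /=; apply/eqP; rewrite eq_complex /=; apply/andP; split; apply/eqP.
    by rewrite mul0r subr0.
  by rewrite mul0r addr0.
have EWE : expect P (fun t => Y t `^ alpha) +
    theta * d1 * expect P (fun t => phi2 (Y t) * Y t `^ alpha) = \int[P]_t W t.
  have := key (fun=> 1) (measurable_cst _); rewrite normr1 => /(_ (fun=> lexx _)).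
  rewrite (_ : \int[P]_t (W t * 1) = \int[P]_t W t); last first.
    by apply: eq_Rintegral => t _; rewrite mulr1.
  move=> <-; congr (expect P _ + _ * expect P _).
    by apply/funext => t; rewrite mulr1.
  by apply/funext => t; rewrite mulr1.
have IWk := intble_mellin_weight mY alpha_gt0 eps0 IZ mw w0 wB.
have IW : intble P W.
  by apply: eq_integrable (IWk 0%N isT) => // t _ /=; rewrite expr0 mulr1.
have W0 t : 0 <= W t by rewrite /W /mellin_weight !mulr_ge0// powR_ge0.
have mlnY : measurable_fun setT (fun t => ln (Y t)).
  exact: (measurableT_comp (@measurable_ln R) mY).
have EW0 : 0 < \int[P]_t W t := total_weight_gt0 W0 nz.
have [U_gt0 [C1 C10 FU]] := tail_product_dominates mphi1 Iphi phi1_lim mk kB kge0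
  joint alpha_gt0 XY_RV F_gt0 IW EW0.
set F := tail P X in F_gt0 FU G_o_F *.
set U := tail P (X \* Y)%R in XY_RV U_gt0 FU *.
have F_noninc : {homo F : x y / x <= y >-> y <= x} by exact: tail_noninc.
have U_noninc : {homo U : x y / x <= y >-> y <= x}.
  by apply: tail_noninc; exact: measurable_funM.
have F_le1 x : F x <= 1 by exact: tail_le1.
have [C C0 hC] := mellin_bounded mY alpha_gt0 eps0 F_noninc F_gt0 F_le1 U_noninc
  U_gt0 XY_RV C10 FU IZ G_o_F.
have htail := tail_negligible F_gt0 U_gt0 XY_RV C10 FU G_o_F.
have VU e (e0 : 0 < e) := tail_product_mellin Y_ge0 mphi1 Iphi phi1_lim mk kB joint
  F_gt0 e0 C0 htail hC.
have := mellin_tauberian mY alpha_gt0 eps0 F_noninc F_gt0 F_le1 U_noninc U_gt0 XY_RV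
  C10 FU IZ G_o_F mw w0 wB nz VU.
set c := \int[P]_t _ => /eventually_cvg FUlim.
have c0 : 0 < c := EW0.
have UFlim : U x / F x @[x --> +oo] --> c.
  have ci0 : c^-1 != 0 by rewrite invr_neq0// gt_eqF.
  have := cvgV ci0 FUlim; rewrite invrK => h.
  have E x : U x / F x = (F x / U x)^-1 by rewrite invf_div.
  by under eq_fun do rewrite E; exact: h.
split.
- move=> y y0; rewrite /asymp_equiv.
  (* [F] inherits regular variation by factoring its ratio through [F / U] at [x * y], the ratio of
     [U], and [U / F] at [x]; the limits [c^-1] and [c] cancel. *)
  have h1 := cvg_mulr_pinfty y0 FUlim.
  have h2 := XY_RV y y0; rewrite /asymp_equiv in h2.
  have := cvgM (cvgM h1 h2) UFlim; rewrite mulr1 mulVf ?gt_eqF// => h3.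
  have E x : F (x * y) / (y `^ (- alpha) * F x) =
      F (x * y) / U (x * y) * (U (x * y) / (y `^ (- alpha) * U x)) * (U x / F x).
    by field; rewrite !gt_eqF ?powR_gt0.
  by under eq_fun do rewrite E; exact: h3.
- rewrite /asymp_equiv EWE -/c.
  have := cvgM (cvg_cst c^-1) UFlim; rewrite mulVf ?gt_eqF// => h3.
  have E x : U x / (c * F x) = c^-1 * (U x / F x).
    by field; rewrite !gt_eqF.
  by under eq_fun do rewrite E; exact: h3.
Qed.
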